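(* Let $n\ge 1$, let $q>1$, and let $C:\mathbb{R}^n\to\mathbb{R}$ be a $C^2$ strictly convex function that is $q$-homogeneous, i.e. $C(\lambda x)=\lambda^qC(x)$ for all $\lambda\ge0$ and $x\in\mathbb{R}^n$, such that $\lim_{\|x\|\to\infty}C(x)/\|x\|=\infty$. Put $\mathcal{L}=\int_{\mathbb{R}^n}e^{-C(x)}dx$ (finite) and let $\mu(dx)=\mathcal{L}^{-1}e^{-C(x)}dx$. Assume that for every $R>0$ and every measurable map $z\mapsto y_0=y_0(z)$ from $\mathbb{R}^n$ to $\mathbb{R}^n$ with $\|\nabla C(y_0(z))\|\le\|\nabla C(z)\|+R$ for all $z$, $$\int_{\mathbb{R}^n}\big(\|z\|+\|y_0\|+R\big)^2\Big(\|\nabla C(z)\|+\sup_{y:\ \|y-z+y_0\|\le R}\|\mathrm{Hess}(C)(y)\|\Big)\,d\mu(z)<+\infty .$$ Let $p$ be defined by $1/p+1/q=1$. Then for every smooth enough function $g:\mathbb{R}^n\to\mathbb{R}$, $$\mathrm{Ent}_{dx}(e^g)\le\frac{n}{p}\int_{\mathbb{R}^n}e^g\,dx\ \log\left(\frac{p}{n\,e^{p-1}\mathcal{L}^{p/n}}\ \frac{\int_{\mathbb{R}^n}C^*(-\nabla g)\,e^g\,dx}{\int_{\mathbb{R}^n}e^g\,dx}\right).$$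
   Context: $\|\cdot\|$ is the Euclidean norm on $\mathbb{R}^n$ (and the operator norm for matrices), and $dx$ is Lebesgue measure. The Fenchel-Legendre transform is $C^*(x)=\sup_{z\in\mathbb{R}^n}\{x\cdot z-C(z)\}$. $\mathrm{Ent}_{dx}(e^g)=\int e^g\log\frac{e^g}{\int e^g\,dx}\,dx$. ''Smooth enough'' means: $g$ is $C^1$ and the functions $e^g$, $ge^g$ and $C^*(-\nabla g)e^g$ are integrable with respect to Lebesgue measure. *)

(* Defs.v *)
From HB Require Import structures.
From mathcomp Require Import all_boot all_order all_algebra.
From mathcomp Require Import all_classical all_reals all_analysis.

Set Implicit Arguments.
Unset Strict Implicit.
Unset Printing Implicit Defensive.
Import Order.TTheory GRing.Theory Num.Theory.
Import numFieldNormedType.Exports.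

Local Open Scope classical_set_scope.
Local Open Scope ring_scope.

(* Vectors of R^n are row vectors 'rV[R]_n. The library's norm `| x | on them
   is the sup norm, hence the separate Euclidean norm below; the two induce the
   same topology and the same notion of differentiability. *)

Section euclidean.
Context {R : realType} {n : nat}.
Implicit Types (x y : 'rV[R]_n) (A : 'M[R]_n).

Definition dot x y : R := \sum_i x ord0 i * y ord0 i.

Definition enorm x : R := Num.sqrt (dot x x).

Definition opnorm A : R :=
  sup [set enorm (v *m A) | v in [set v : 'rV[R]_n | enorm v <= 1]].

End euclidean.

Section calculus.
Context {R : realType} {n : nat}.
Implicit Types (f : 'rV[R]_n -> R) (x : 'rV[R]_n).

Definition grad f x : 'rV[R]_n := \row_i 'D_(delta_mx ord0 i) f x.

(* Entry (i, j) is the i-th partial derivative of the j-th partial of f. *)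
Definition hess f x : 'M[R]_n := 'J (grad f) x.

Definition class_C1 f : Prop :=
  (forall x, differentiable f x) /\ continuous (grad f).

Definition class_C2 f : Prop :=
  [/\ class_C1 f, forall x, differentiable (grad f) x & continuous (hess f)].

Definition strictly_convex f : Prop := forall x y (t : R),
  x != y -> 0 < t < 1 -> f (t *: x + (1 - t) *: y) < t * f x + (1 - t) * f y.

Definition homogeneous (q : R) f : Prop :=
  forall (l : R) x, 0 <= l -> f (l *: x) = l `^ q * f x.

(* f x / ||x|| tends to +oo as ||x|| tends to +oo. *)
Definition superlinear f : Prop :=
  forall A : R, exists M : R, forall x, M < enorm x -> A < f x / enorm x.

Definition fenchel f x : \bar R :=
  ereal_sup [set (dot x z - f z)%:E | z in [set: 'rV[R]_n]].

End calculus.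

Definition measure_rV_display : measure_display -> measure_display.
Proof. exact. Qed.

(* 'rV[T]_n carries the product sigma-algebra, as n.-tuple T does in the
   library; for T = R this is the Borel sigma-algebra of R^n. *)
Section measurable_rV.
Context {d} {T : measurableType d}.
Variable n : nat.

Definition rV_coord (i : 'I_n) (x : 'rV[T]_n) : T := x ord0 i.

Let rV_set0 : g_sigma_preimage rV_coord set0.
Proof. exact: sigma_algebra0. Qed.

Let rV_setC A : g_sigma_preimage rV_coord A -> g_sigma_preimage rV_coord (~` A).
Proof. exact: sigma_algebraC. Qed.

Let rV_bigcup (F : _^nat) : (forall i, g_sigma_preimage rV_coord (F i)) ->
  g_sigma_preimage rV_coord (\bigcup_i (F i)).
Proof. exact: sigma_algebra_bigcup. Qed.

HB.instance Definition _ := @isMeasurable.Build (measure_rV_display d)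
  'rV[T]_n (g_sigma_preimage rV_coord) rV_set0 rV_setC rV_bigcup.

End measurable_rV.

Lemma measurable_rV_coord d (T : measurableType d) n (i : 'I_n) :
  measurable_fun [set: 'rV[T]_n] (rV_coord i).
Proof.
move=> _ Y mY; rewrite setTI; apply: sub_sigma_algebra => /=.
rewrite -bigcup_seq/=; exists i => /=; first by rewrite mem_index_enum.
by exists Y => //; rewrite setTI.
Qed.

Lemma measurable_fun_rVP d1 d2 (T1 : measurableType d1) (T2 : measurableType d2)
    n (f : T1 -> 'rV[T2]_n) :
  measurable_fun [set: T1] f <->
  forall i, measurable_fun [set: T1] (rV_coord i \o f).
Proof.
split=> [mf i|mf].
  by apply: measurableT_comp mf; exact: measurable_rV_coord.
have : g_sigma_preimage (fun i => rV_coord i \o f) `<=` measurable.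
  apply: smallest_sub; first exact: sigma_algebra_measurable.
  rewrite -bigcup_seq; apply: bigcup_sub => i _ A [B mB <-].
  exact: mf.
rewrite g_sigma_preimage_comp => prefS _ A mA.
by apply: prefS; exists A.
Qed.

(* Lebesgue measure on R^n, by iterating the product with the Lebesgue measure
   of R along R^(n+1) = R * R^n; on R^0, a single point of mass 1. *)
Section lebesgue_rV.
Context {R : realType}.

Definition cons_rV n (xv : R * 'rV[R]_n) : 'rV[R]_n.+1 :=
  row_mx (const_mx xv.1 : 'rV_1) xv.2.

Definition uncons_rV n (x : 'rV[R]_n.+1) : R * 'rV[R]_n :=
  (x ord0 ord0, \row_i x ord0 (lift ord0 i)).

Lemma cons_rV0 n (xv : R * 'rV[R]_n) : cons_rV xv ord0 ord0 = xv.1.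
Proof.
have -> : (ord0 : 'I_(1 + n)) = lshift n (ord0 : 'I_1) by exact/val_inj.
by rewrite [LHS]row_mxEl mxE.
Qed.

Lemma cons_rVS n (xv : R * 'rV[R]_n) (i : 'I_n) :
  cons_rV xv ord0 (lift ord0 i) = xv.2 ord0 i.
Proof.
have -> : (lift ord0 i : 'I_(1 + n)) = rshift 1 i by exact/val_inj.
by rewrite [LHS]row_mxEr.
Qed.

Lemma cons_rVK n : cancel (@cons_rV n) (@uncons_rV n).
Proof.
move=> [a v]; congr pair; first exact: cons_rV0.
by apply/rowP => i; rewrite mxE cons_rVS.
Qed.

Lemma measurable_cons_rV n : measurable_fun [set: R * 'rV[R]_n] (@cons_rV n).
Proof.
apply/measurable_fun_rVP => i; case: (unliftP ord0 i) => [j|] ->.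
  rewrite (_ : _ \o _ = rV_coord j \o snd).
    by apply: measurableT_comp => //; exact: measurable_rV_coord.
  by apply/funext => xv; exact: cons_rVS.
rewrite (_ : _ \o _ = fst) //.
by apply/funext => xv; exact: cons_rV0.
Qed.

Lemma measurable_uncons_rV n : measurable_fun [set: 'rV[R]_n.+1] (@uncons_rV n).
Proof.
apply/measurable_fun_pairP; split.
  exact: (@measurable_rV_coord _ R n.+1 ord0).
apply/measurable_fun_rVP => i.
rewrite (_ : _ \o _ = rV_coord (lift ord0 i)); first exact: measurable_rV_coord.
by apply/funext => x; rewrite /rV_coord /= mxE.
Qed.

Section step.
Variables (n : nat) (m : {sigma_finite_measure set 'rV[R]_n -> \bar R}).

Definition cons_measure : set 'rV[R]_n.+1 -> \bar R :=
  pushforward (lebesgue_measure \x m)%E (@cons_rV n).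

Let cons_measure0 : cons_measure set0 = 0%E.
Proof. have mf := @measurable_cons_rV n; exact: measure0. Qed.

Let cons_measure_ge0 A : (0 <= cons_measure A)%E.
Proof. have mf := @measurable_cons_rV n; exact: measure_ge0. Qed.

Let cons_measure_sigma_additive : semi_sigma_additive cons_measure.
Proof.
have mf := @measurable_cons_rV n; exact: measure_semi_sigma_additive.
Qed.

HB.instance Definition _ := isMeasure.Build _ _ _ cons_measure
  cons_measure0 cons_measure_ge0 cons_measure_sigma_additive.

Lemma cons_measureE (A : set R) (B : set 'rV[R]_n) :
  measurable A -> measurable B ->
  cons_measure (@uncons_rV n @^-1` (A `*` B)) = (lebesgue_measure A * m B)%E.
Proof.
move=> mA mB; rewrite /cons_measure /pushforward -comp_preimage.
rewrite (_ : _ \o _ = id); last exact/funext/cons_rVK.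
by rewrite preimage_id; exact: product_measure1E.
Qed.

Let cons_measure_sigma_finite : sigma_finite setT cons_measure.
Proof.
have /sigma_finiteP[F [FT ndF Foo]] := sigma_finiteT (@lebesgue_measure R).
have /sigma_finiteP[G [GT ndG Goo]] := sigma_finiteT m.
exists (fun i => @uncons_rV n @^-1` (F i `*` G i)).
  rewrite -preimage_bigcup (_ : \bigcup_i _ = setT) ?preimage_setT//.
  rewrite -setXTT FT GT predeqE => -[x y]; split.
    by move=> [i _ []/= ? ?]; split; exists i.
  move=> [/= [i _ Fx] [k _ Gy]]; exists (maxn i k) => //; split.
  - by move: x Fx; exact/subsetPset/ndF/leq_maxl.
  - by move: y Gy; exact/subsetPset/ndG/leq_maxr.
move=> i; have [mF Fi] := Foo i; have [mG Gi] := Goo i; split.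
  rewrite -[X in measurable X]setTI.
  by apply: measurable_uncons_rV => //; exact: measurableX.
by rewrite cons_measureE// lte_mul_pinfty// ge0_fin_numE.
Qed.

HB.instance Definition _ := Measure_isSigmaFinite.Build _ _ _ cons_measure
  cons_measure_sigma_finite.

End step.

Fixpoint lebesgue_rV n : {sigma_finite_measure set 'rV[R]_n -> \bar R} :=
  match n with
  | 0 => \d_(0 : 'rV[R]_0)
  | n'.+1 => cons_measure (lebesgue_rV n')
  end.

Lemma measurable_box n (A : 'I_n -> set R) : (forall i, measurable (A i)) ->
  measurable [set x : 'rV[R]_n | forall i, A i (x ord0 i)].
Proof.
move=> mA; have -> : [set x : 'rV[R]_n | forall i, A i (x ord0 i)] =
    \big[setI/setT]_(i < n) (rV_coord i @^-1` A i).
  rewrite -bigcap_seq; apply/seteqP; split=> [x Ax i _|x Ax i] /=; first exact: Ax.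
  by apply: (Ax i); rewrite /= mem_index_enum.
apply: bigsetI_measurable => i _; rewrite -[_ @^-1` _]setTI.
by apply: measurable_rV_coord.
Qed.

Lemma lebesgue_rV_box n (A : 'I_n -> set R) : (forall i, measurable (A i)) ->
  lebesgue_rV n [set x | forall i, A i (x ord0 i)] =
  (\prod_(i < n) lebesgue_measure (A i))%E.
Proof.
elim: n A => [|n IHn] A mA.
  by rewrite big_ord0 /= diracE mem_set//= => -[].
rewrite big_ord_recl -IHn; last by move=> i; exact: mA.
rewrite -cons_measureE//; last first.
  by apply: (@measurable_box n (fun i => A (lift ord0 i))) => i; exact: mA.
congr (cons_measure _ _); apply/seteqP; split=> x /= Ax.
  by split=> [|i]; [exact: Ax|rewrite mxE; exact: Ax].
case: Ax => Ax0 AxS i; case: (unliftP ord0 i) => [j|] -> //.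
by have := AxS j; rewrite mxE.
Qed.

End lebesgue_rV.
Arguments lebesgue_rV {R} n.

Section functionals.
Context {R : realType} {n : nat}.
Implicit Types (f g C : 'rV[R]_n -> R).

Local Notation dx := (lebesgue_rV n).

Definition entropy f : R :=
  \int[dx]_x (f x * ln (f x / \int[dx]_y f y)).

Definition gibbs_mass C : R := \int[dx]_x expR (- C x).

(* The measure mu(dx) = L^-1 e^(-C(x)) dx, as a set function; like the library's
   normal_prob, it is given by its density, whose measurability needs that of C. *)
Definition gibbs C (A : set 'rV[R]_n) : \bar R :=
  (\int[dx]_(x in A) ((gibbs_mass C)^-1 * expR (- C x))%:E)%E.

(* The integral is finite under smooth_enough below. *)
Definition fenchel_energy C g : R :=
  fine (\int[dx]_x (fenchel C (- grad g x) * (expR (g x))%:E))%E.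

Definition smooth_enough C g : Prop :=
  [/\ class_C1 g,
      dx.-integrable setT (fun x => (expR (g x))%:E),
      dx.-integrable setT (fun x => (g x * expR (g x))%:E) &
      dx.-integrable setT
        (fun x => fenchel C (- grad g x) * (expR (g x))%:E)%E].

Definition growth_condition C : Prop :=
  forall (r : R) (y0 : 'rV[R]_n -> 'rV[R]_n), 0 < r ->
    measurable_fun [set: 'rV[R]_n] y0 ->
    (forall z, enorm (grad C (y0 z)) <= enorm (grad C z) + r) ->
  (\int[gibbs C]_z (((enorm z + enorm (y0 z) + r) ^+ 2)%:E *
      ((enorm (grad C z))%:E +
       ereal_sup [set (opnorm (hess C y))%:E |
                  y in [set y | enorm (y - z + y0 z)%R <= r]%R])) < +oo)%E.

End functionals.

(* Main.v *)
(** Let [f = e^g], [Z] its integral, [L] the integral of [e^-C], and [k > 0].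
    Apply the Prekopa-Leindler inequality with weights [1 - s] and [s] to [f],
    to [e^-C], and to a majorant of the sup-convolution along [x + (k s) y].
    To first order in [s], the majorant is
    [e^g (1 + s (- g + sup_y (- k grad g . y - C y)))], so letting [s] tend
    to [0] gives
      [Z (n ln k + n + ln L - ln Z) <= k^p \int C^*(- grad g) f - \int g f],
    because [C^*] is [p]-homogeneous; the choice
    [k^p = n Z / (p \int C^*(- grad g) f)] is optimal and yields the theorem.
    No decay of [g] is needed: [f] is first restricted to a ball of radius [r]
    and [e^-C] to a ball of radius [M]. The mass of the shell of width [k s M]
    around the first ball is at most [e k s M] for suitable arbitrarily large
    [r], since the mass of the balls is bounded and monotone in [r]. *)
Require Import Defs.
From mathcomp Require Import all_boot all_order all_algebra.
From mathcomp Require Import all_classical all_reals all_analysis.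
From mathcomp Require Import measurable_realfun ring lra.

Set Implicit Arguments.
Unset Strict Implicit.
Unset Printing Implicit Defensive.
Import Order.TTheory GRing.Theory Num.Theory.
Import numFieldNormedType.Exports.

Local Open Scope classical_set_scope.
Local Open Scope ring_scope.

(** * The Prekopa-Leindler inequality on the line *)

(** The sup-convolution never appears: its measurability would be a separate question, so each
    inequality is stated for a measurable majorant [w]. All balls are balls of the sup norm, that is
    cubes: their volume is a product and their sections are controlled coordinate by coordinate.
    Truncation serves two purposes. Bounded functions of bounded support have finite integrals and
    marginals of the same kind, so the induction on the dimension runs with real-valued integrals;
    and a $C^1$ function has a uniform first-order expansion on bounded sets only. The order of the
    limits matters: first $s \to 0$ with [r], [M], [e] fixed; then $e \to 0$ along radii [r] tending
    to infinity, still at fixed [M], since the shell costs [e * (k * M)]; last $M \to \infty$. The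
    integrability of $e^{-C}$ is obtained in that last step, because the inequality itself bounds
    the truncated masses uniformly in [M]. The summand [n] next to [n ln k] comes from the Jacobian
    constant of Prekopa-Leindler: $-n(1-s)\ln(1-s)$ is $ns$ to first order. *)

Lemma lebesgue_measure_affine_preimage (R : realType) (c a : R)
    (A : set (measurableTypeR R)) : 0 < c -> measurable A ->
  lebesgue_measure A =
  (c%:E * lebesgue_measure ((fun x => c * x + a)%R @^-1` A))%E.
Proof.
move=> c0 mA.
pose f : measurableTypeR R -> measurableTypeR R := fun x => c * x + a.
have mf : measurable_fun setT f.
  by apply: measurable_funD => //; exact: mulrl_measurable.
pose mu : {measure set (measurableTypeR R) -> \bar R} :=
  pushforward (@lebesgue_measure R) f.
rewrite (_ : (_ * _)%E = mscale (NngNum (ltW c0)) (mu mf) A) //.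
apply: lebesgue_measure_unique => // X [[x y] /= xy <-].
rewrite /mscale/= /mu/= /pushforward.
rewrite (_ : f @^-1` _ = `](x - a) / c, (y - a) / c]%classic); last first.
  apply/seteqP; split => z; rewrite /= !in_itv/= /f => /andP[h1 h2];
    apply/andP; split; move: h1 h2;
    by rewrite ?ltr_pdivrMr// ?ler_pdivlMr// => h1 h2; lra.
rewrite !lebesgue_measure_itv/= !lte_fin ltr_pM2r ?invr_gt0// ltrD2r.
case: ifP => _; last by rewrite mule0.
by rewrite -!EFinD -EFinM; congr EFin; field; rewrite gt_eqF.
Qed.

(* With a near sup A and b near inf B, the translates A + s b and a + s B
   overlap in a short interval only. *)
Lemma lebesgue_measure_sumset_ge (R : realType) (s K : R)
    (A B D : set (measurableTypeR R)) : 0 < s ->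
  measurable A -> measurable B -> measurable D -> A !=set0 -> B !=set0 ->
  (forall x, A x -> `|x| <= K) -> (forall x, B x -> `|x| <= K) ->
  (forall a b, A a -> B b -> D (a + s * b)) ->
  (lebesgue_measure A + s%:E * lebesgue_measure B <= lebesgue_measure D)%E.
Proof.
move=> s0 mA mB mD A0 B0 AK BK ABD.
apply/lee_addgt0Pr => _/posnumP[e].
(* With this tolerance [e'] on both sides, the overlap lies in an interval of length [(1 + s) * e'],
   which is exactly the allowed error [e]. *)
have e1 : 0 < e%:num / (1 + s) by rewrite divr_gt0// addr_gt0.
have supA : has_sup A.
  by split=> //; exists K => x /AK; apply: le_trans; exact: ler_norm.
have infB : has_inf B.
  by split=> //; exists (- K) => x /BK; rewrite ler_norml => /andP[].
have [a Aa aA] := sup_adherent e1 supA.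
have [b Bb bB] := inf_adherent e1 infB.
set e' := _ / _ in e1 aA bB.
pose P := (fun x => 1 * x + (- (s * b)))%R @^-1` A.
pose Q := (fun x => s^-1 * x + (- (a / s)))%R @^-1` B.
have mP : measurable P.
  rewrite -[P]setTI; apply: measurable_funD => //; exact: mulrl_measurable.
have mQ : measurable Q.
  rewrite -[Q]setTI; apply: measurable_funD => //; exact: mulrl_measurable.
have lP : lebesgue_measure A = lebesgue_measure P.
  by rewrite (lebesgue_measure_affine_preimage (- (s * b)) ltr01 mA) mul1e.
have lQ : (s%:E * lebesgue_measure B = lebesgue_measure Q)%E.
  have si : 0 < s^-1 by rewrite invr_gt0.
  rewrite (lebesgue_measure_affine_preimage (- (a / s)) si mB) muleA -EFinM.
  by rewrite divff ?gt_eqF// mul1e.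
have Qfin : (lebesgue_measure Q < +oo)%E.
  rewrite -lQ lte_mul_pinfty ?lee_fin ?(ltW s0)//.
  apply: (@le_lt_trans _ _ (lebesgue_measure `[- K, K]%classic)).
    apply: le_measure; rewrite ?inE// => x /BK.
    by rewrite /= in_itv/= ler_norml.
  by rewrite lebesgue_measure_itv/=; case: ifP => _; rewrite ?ltry// -EFinB ltry.
have PQD : P `|` Q `<=` D.
  move=> x [Ax|Bx].
    by have := ABD _ _ Ax Bb; rewrite mul1r subrK.
  have := ABD _ _ Aa Bx; congr D.
  by field; rewrite gt_eqF.
have PQ : (lebesgue_measure (P `&` Q) <= (e%:num)%:E)%E.
  apply: (@le_trans _ _ (lebesgue_measure
      `[a + s * b - s * e', a + s * b + e']%classic)).
    apply: le_measure; rewrite ?inE//; first exact: measurableI.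
    move=> x [Ax Bx]; rewrite /= in_itv/=; apply/andP; split.
      have : inf B <= s^-1 * x + - (a / s) by apply: ge_inf => //; case: infB.
      move=> /(lt_le_trans _) h; have := h (b - e').
      rewrite ltrBlDr => /(_ bB); rewrite [ltRHS](_ : _ = (x - a) / s).
        by rewrite ltr_pdivlMr// => hh; lra.
      by field; rewrite gt_eqF.
    have : 1 * x + - (s * b) <= sup A by apply: ub_le_sup => //; case: supA.
    by lra.
  rewrite lebesgue_measure_itv/= lte_fin ifT; last first.
    by rewrite ltrBlDr -addrA ltrDl addr_gt0// mulr_gt0.
  rewrite -EFinB lee_fin [leLHS](_ : _ = e' * (1 + s)); last by ring.
  by rewrite /e' divfK// gt_eqF// addr_gt0.
rewrite lP lQ.
have := measureUfinr (mu := @lebesgue_measure R) mP mQ Qfin.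
set m := lebesgue_measure.
have PQfin : m (P `&` Q) \is a fin_num.
  by rewrite ge0_fin_numE//; apply: le_lt_trans PQ _; rewrite ltry.
move=> /(congr1 (fun z => z + m (P `&` Q)))%E; rewrite subeK// => <-.
by apply: leeD => //; apply: le_measure; rewrite ?inE//; exact: measurableU.
Qed.

(** Tonelli for the indicator of the region under the graph. The condition [0 <= t] sits inside the
    level set, so that [t] ranges over the whole line; measurability in [t] is returned as well, for
    the later comparison of level integrals. *)
Lemma layer_cake d (T : measurableType d) (R : realType)
    (mu : {sigma_finite_measure set T -> \bar R}) (f : T -> R) :
  measurable_fun setT f -> (forall x, 0 <= f x) ->
  measurable_fun setT (fun t : R => mu [set x | 0 <= t < f x]) /\
  (\int[mu]_x (f x)%:E =
   \int[lebesgue_measure]_t mu [set x | (0 <= t < f x)%R])%E.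
Proof.
move=> mf f0.
pose h (p : T * measurableTypeR R) : \bar R :=
  (\1_[set p | 0 <= p.2 < f p.1] p)%:E.
have mE : measurable [set p : T * measurableTypeR R | 0 <= p.2 < f p.1].
  rewrite (_ : mkset _ = [set p | 0 <= p.2] `&` [set p | p.2 < f p.1]); last first.
    by apply/seteqP; split => p /= => [/andP[]|[-> ->]].
  apply: measurableI.
    have : measurable_fun setT (fun p : T * measurableTypeR R => 0 <= p.2).
      exact: measurable_fun_ler.
    by move=> /(_ measurableT [set true]); rewrite setTI; exact.
  have : measurable_fun setT (fun p : T * measurableTypeR R => p.2 < f p.1).
    by apply: measurable_fun_ltr => //; exact: measurableT_comp.
  by move=> /(_ measurableT [set true]); rewrite setTI; exact.
have mh : measurable_fun setT h by exact/measurable_EFinP/measurable_indic.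
have h0 p : (0 <= h p)%E by rewrite /h lee_fin indicE.
have hG : fubini_G mu h = fun t => mu [set x | 0 <= t < f x].
  apply/funext => t; rewrite /fubini_G /h.
  transitivity (\int[mu]_x (\1_[set x | (0 <= t < f x)%R] x)%:E)%E => //.
  rewrite integral_indic ?setIT//.
  by have := measurable_ysection t mE; rewrite /ysection/=; congr measurable;
    apply/seteqP; split => x /=; rewrite inE.
split.
  by rewrite -hG; exact: measurable_fun_fubini_tonelli_G.
transitivity (\int[mu]_x fubini_F lebesgue_measure h x)%E.
  apply: eq_integral => x _; rewrite /fubini_F /h.
  transitivity (\int[lebesgue_measure]_t (\1_`[0%R, f x[%classic t)%:E)%E.
    rewrite integral_indic ?setIT//.
    rewrite [RHS](lebesgue_measure_itv `[0, f x[)/= lte_fin.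
    case: ltP => h1; first by rewrite -EFinB subr0.
    by congr EFin; apply/eqP; rewrite eq_le h1 f0.
  apply: eq_integral => t _; congr EFin; rewrite !indicE.
by rewrite -hG; exact: fubini_tonelli.
Qed.

Lemma weighted_am_gm (R : realType) (s a b : R) : 0 < s < 1 ->
  0 <= a -> 0 <= b -> a `^ (1 - s) * b `^ s <= (1 - s) * a + s * b.
Proof.
move=> /andP[s0 s1] a0 b0.
have s1' : 0 < 1 - s by rewrite subr_gt0.
have := @conjugate_powR R (a `^ (1 - s)) (b `^ s) (1 - s)^-1 s^-1.
rewrite !invrK -!powRrM !divff ?gt_eqF// !powRr1// => h.
rewrite mulrC (mulrC (1 - s)) (mulrC s) mulrC; apply: h; rewrite ?powR_ge0 ?invr_gt0//.
by rewrite subrK.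
Qed.

(** A single [K] bounds both the values and the support. The gauge [N] is a parameter so that the
    notion covers the absolute value on the line and the sup norm on $\mathbb{R}^n$. *)
Definition bdd_supp d (T : measurableType d) (R : realType) (N f : T -> R) :=
  measurable_fun setT f /\
  exists K, forall x, 0 <= f x <= K /\ (K < N x -> f x = 0).

(** Since $t^{1-s} t^s = t$, the set where [w] exceeds [t] contains the sum of the set where [u]
    exceeds [t] and [c] times that for [v]. Both suprema being 1, these sets are nonempty for the
    same [t], namely all [t] below 1, so the sumset inequality applies at each level in $[0,1)$ and
    the layer cake formula integrates it. This yields a sum, stronger than the usual geometric
    mean. *)
Lemma prekopa_leindler_sup1 (R : realType) (u v w : measurableTypeR R -> R)
    (s c K : R) : 0 < s < 1 -> 0 < c ->
  measurable_fun setT u -> measurable_fun setT v -> measurable_fun setT w ->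
  (forall x, 0 <= u x <= 1) -> (forall x, 0 <= v x <= 1) ->
  (forall x, 0 <= w x) ->
  (forall x, K < `|x| -> u x = 0) -> (forall x, K < `|x| -> v x = 0) ->
  (forall t, t < 1 -> exists x, t < u x) ->
  (forall t, t < 1 -> exists x, t < v x) ->
  (forall x y, u x `^ (1 - s) * v y `^ s <= w (x + c * y)) ->
  (\int[lebesgue_measure]_x (u x)%:E + c%:E * \int[lebesgue_measure]_x (v x)%:E
   <= \int[lebesgue_measure]_x (w x)%:E)%E.
Proof.
move=> /andP[s0 s1] c0 mu mv mw u01 v01 w0 Ku Kv su sv uvw.
have u0 x : 0 <= u x by case/andP: (u01 x).
have v0 x : 0 <= v x by case/andP: (v01 x).
have [mlu ->] := layer_cake (@lebesgue_measure R) mu u0.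
have [mlv ->] := layer_cake (@lebesgue_measure R) mv v0.
have [mlw ->] := layer_cake (@lebesgue_measure R) mw w0.
rewrite -ge0_integralZl_EFin ?(ltW c0)// -ge0_integralD//; last 2 first.
  by move=> t _; rewrite mule_ge0 ?lee_fin ?(ltW c0).
  exact: measurable_funeM.
apply: ge0_le_integral => //.
  by move=> t _; rewrite adde_ge0// mule_ge0 ?lee_fin ?(ltW c0).
  by apply: emeasurable_funD => //; exact: measurable_funeM.
move=> t _ /=; have [t0|t0] := ltP t 0.
  have E (f : measurableTypeR R -> R) : [set x | false && (t < f x)] = set0.
    by apply/seteqP; split.
  by rewrite !E !measure0 mule0 adde0.
have [t1|t1] := leP 1 t.
  have E (f : measurableTypeR R -> R) :
      (forall x, 0 <= f x <= 1) -> [set x | true && (t < f x)] = set0.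
    move=> f01; apply/seteqP; split => x //=.
    by case/andP: (f01 x) => _ fx /lt_le_trans => /(_ _ fx); rewrite ltNge t1.
  by rewrite (E u)// (E v)// !measure0 mule0 adde0.
have E (f : measurableTypeR R -> R) : [set x | true && (t < f x)] = [set x | t < f x].
  by apply/seteqP; split.
rewrite !E; have mE (f : measurableTypeR R -> R) : measurable_fun setT f ->
    measurable [set x | t < f x].
  move=> mf; have : measurable_fun setT (fun x => t < f x).
    by apply: measurable_fun_ltr.
  by move=> /(_ measurableT [set true]); rewrite setTI; exact.
apply: (@lebesgue_measure_sumset_ge R c K) => //; try exact: mE.
- by have [x] := su _ t1; exists x.
- by have [x] := sv _ t1; exists x.
- by move=> x /= h; rewrite leNgt; apply/negP => /Ku ux; move: h; rewrite ux ltNge t0.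
- by move=> x /= h; rewrite leNgt; apply/negP => /Kv ux; move: h; rewrite ux ltNge t0.
move=> x y /= tx ty; apply: lt_le_trans (uvw x y).
rewrite -[t]powRr1// -[X in t `^ X](subrK s) powRD; last by rewrite subrK oner_eq0.
by apply: ltr_pM; rewrite ?powR_ge0//; apply: gt0_ltr_powR;
  rewrite ?subr_gt0 ?nnegrE.
Qed.


(** The Jacobian factor of $x = (1-s)x'$, $y = (s/c)y'$, which turns $x + cy$ into the usual
    $(1-s)x' + sy'$. At [c = k * s] its logarithm is $s(\ln k + 1)$ to first order. *)
Definition pl_cst (R : realType) (s c : R) : R :=
  (1 - s) `^ (- (1 - s)) * (c / s) `^ s.

Lemma bdd_supp_integrable d (T : measurableType d) (R : realType)
    (mu : {measure set T -> \bar R}) (N f : T -> R) :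
  measurable_fun setT N -> (forall K, (mu [set x | (N x <= K)%R] < +oo)%E) ->
  bdd_supp N f -> mu.-integrable setT (EFin \o f).
Proof.
move=> mN muN [mf [K fK]].
have mD : measurable [set x | N x <= K].
  have : measurable_fun setT (fun x => N x <= K) by exact: measurable_fun_ler.
  by move=> /(_ measurableT [set true]); rewrite setTI; exact.
apply: (@le_integrable _ _ _ _ _ _ _ (fun x => (K * \1_[set x | N x <= K] x)%:E)) => //.
- exact/measurable_EFinP.
- move=> x _ /=; rewrite lee_fin indicE.
  case/(_ x): fK => /andP[f0 fk] nf.
  have [xK|xK] := leP (N x) K.
    by rewrite mem_set// mulr1 !ger0_norm// (le_trans f0).
  by rewrite nf// normr0.
- rewrite (_ : (fun _ => _) =
      fun x => (K%:E * (\1_[set x | N x <= K] x)%:E)%E); last first.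
    by apply/funext => x; rewrite EFinM.
  apply: integrableZl => //; apply/integrableP; split.
    exact/measurable_EFinP/measurable_indic.
  rewrite (eq_integral (fun x => (\1_[set x | (N x <= K)%R] x)%:E)) => [|y _].
    by rewrite integral_indic ?setIT.
  by rewrite gee0_abs// lee_fin.
Qed.

Lemma bdd_supp_R_integrable (R : realType) (f : measurableTypeR R -> R) :
  bdd_supp (fun x : measurableTypeR R => `|x|) f ->
  (@lebesgue_measure R).-integrable setT (EFin \o f).
Proof.
apply: bdd_supp_integrable; first exact: normr_measurable.
move=> K; rewrite (_ : mkset _ = `[- K, K]%classic); last first.
  by apply/seteqP; split => x /=; rewrite in_itv/= ler_norml.
rewrite [X in (X < _)%E](lebesgue_measure_itv `[- K, K])/=.
by case: ifP => _; rewrite ?ltry// -EFinB ltry.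
Qed.

(** Dividing [u] and [v] by their suprema [A] and [B], and [w] by $D = A^{1-s}B^s$, reduces to
    suprema equal to 1. The resulting sum becomes a product by the weighted arithmetic-geometric
    mean inequality, and the powers of [A] and [B] cancel against [D]. *)
Lemma prekopa_leindler_R (R : realType) (u v w : measurableTypeR R -> R) (s c : R) :
  0 < s < 1 -> 0 < c -> bdd_supp (fun x : measurableTypeR R => `|x|) u ->
  bdd_supp (fun x : measurableTypeR R => `|x|) v ->
  bdd_supp (fun x : measurableTypeR R => `|x|) w ->
  (forall x y, u x `^ (1 - s) * v y `^ s <= w (x + c * y)) ->
  pl_cst s c * (\int[lebesgue_measure]_x u x) `^ (1 - s) *
    (\int[lebesgue_measure]_x v x) `^ s <= \int[lebesgue_measure]_x w x.
Proof.
move=> s01 c0 bu bv bw uvw; have /andP[s0 s1] := s01.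
have int := @bdd_supp_R_integrable R.
have [mu [Ku uK]] := bu; have [mv [Kv vK]] := bv; have [mw [Kw wK]] := bw.
have w0 x : 0 <= w x by case: (wK x) => /andP[].
have W0 : 0 <= \int[lebesgue_measure]_x w x by apply: Rintegral_ge0.
have ubd (f : measurableTypeR R -> R) K :
  (forall x, 0 <= f x <= K /\ (K < `|x| -> f x = 0)) ->
  has_sup (range f) /\ 0 <= sup (range f).
  move=> fK; have h : has_sup (range f).
    split; first by exists (f 0), 0.
    by exists K => _ [x _ <-]; case: (fK x) => /andP[].
  split=> //; apply: (@le_trans _ _ (f 0)); first by case: (fK 0) => /andP[].
  by apply: ub_le_sup; [case: h|exists 0].
have [hu A0] := ubd _ _ uK; have [hv B0] := ubd _ _ vK.
set A := sup _ in hu A0; set B := sup _ in hv B0.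
have uA x : u x <= A by apply: ub_le_sup; [case: hu|exists x].
have vB x : v x <= B by apply: ub_le_sup; [case: hv|exists x].
have triv (f : measurableTypeR R -> R) K S :
  (forall x, 0 <= f x <= K /\ (K < `|x| -> f x = 0)) ->
  (forall x, f x <= S) -> S = 0 -> \int[lebesgue_measure]_x f x = 0.
  move=> fK fS S0; rewrite (_ : f = cst 0) ?Rintegral_cst ?mul0r//.
  apply/funext => x; apply/eqP; rewrite eq_le -{1}S0 fS/=.
  by case: (fK x) => /andP[].
(* A zero supremum cannot be normalized, but then the function vanishes and so does the left-hand
   side. *)
have [A0'|A0'] := eqVneq A 0.
  rewrite (triv _ _ _ uK uA A0') powR0 ?mulr0 ?mul0r//.
  by rewrite gt_eqF// subr_gt0.
have [B0'|B0'] := eqVneq B 0.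
  by rewrite (triv _ _ _ vK vB B0') powR0 ?mulr0// gt_eqF.
have Ap : 0 < A by rewrite lt_neqAle eq_sym A0' A0.
have Bp : 0 < B by rewrite lt_neqAle eq_sym B0' B0.
pose D := A `^ (1 - s) * B `^ s.
have Dp : 0 < D by rewrite mulr_gt0 ?powR_gt0.
have := @prekopa_leindler_sup1 R (fun x => A^-1 * u x) (fun x => B^-1 * v x)
  (fun x => D^-1 * w x) s c (Num.max Ku Kv) s01 c0.
have mZ k (f : measurableTypeR R -> R) : measurable_fun setT f ->
  measurable_fun setT (fun x => k * f x).
  by move=> mf; exact: measurable_funM.
have h01 S (f : measurableTypeR R -> R) K : 0 < S ->
  (forall x, 0 <= f x <= K /\ (K < `|x| -> f x = 0)) ->
  (forall x, f x <= S) -> forall x, 0 <= S^-1 * f x <= 1.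
  move=> S0 fK fS x; rewrite mulr_ge0 ?invr_ge0 ?(ltW S0)//=; last first.
    by case: (fK x) => /andP[].
  by rewrite mulrC ler_pdivrMr// mul1r.
have hs S (f : measurableTypeR R -> R) : 0 < S -> S = sup (range f) ->
    has_sup (range f) -> forall t, t < 1 -> exists x, t < S^-1 * f x.
  move=> S0 SE hf t t1.
  have e0 : 0 < S * (1 - t) by rewrite mulr_gt0// subr_gt0.
  have [_ [x _ <-]] := sup_adherent e0 hf; rewrite -SE => h; exists x.
  by rewrite mulrC ltr_pdivlMr//; move: h; congr (_ < _); ring.
move=> /(_ (mZ _ _ mu) (mZ _ _ mv) (mZ _ _ mw) (h01 _ _ _ Ap uK uA) (h01 _ _ _ Bp vK vB)).
have w0' x : 0 <= D^-1 * w x by rewrite mulr_ge0// invr_ge0 ltW.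
have iA : 0 < A^-1 by rewrite invr_gt0.
have iB : 0 < B^-1 by rewrite invr_gt0.
have sup0 S (f : measurableTypeR R -> R) K K' :
    (forall x, 0 <= f x <= K /\ (K < `|x| -> f x = 0)) -> K <= K' ->
    forall x, K' < `|x| -> S^-1 * f x = 0.
  by move=> fK KK' x Kx; case: (fK x) => _ ->; rewrite ?mulr0// (le_lt_trans KK').
have Kl : Ku <= Num.max Ku Kv by rewrite le_max lexx.
have Kr : Kv <= Num.max Ku Kv by rewrite le_max lexx orbT.
move=> /(_ w0' (sup0 _ _ _ _ uK Kl) (sup0 _ _ _ _ vK Kr)).
move=> /(_ (hs _ _ Ap erefl hu) (hs _ _ Bp erefl hv)).
have Vpow x r : 0 <= x -> (x^-1) `^ r = (x `^ r)^-1 :> R.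
  by move=> x0; rewrite -(powR_inv1 x0) -powRrM mulN1r powRN.
have uvw' x y : (A^-1 * u x) `^ (1 - s) * (B^-1 * v y) `^ s <= D^-1 * w (x + c * y).
  have u0 : 0 <= u x by case: (uK x) => /andP[].
  have v0 : 0 <= v y by case: (vK y) => /andP[].
  rewrite !powRM ?(ltW iA) ?(ltW iB)// !Vpow//.
  rewrite mulrACA -invfM; apply: ler_wpM2l (uvw _ _).
  by rewrite invr_ge0 ltW.
move=> /(_ uvw').
have eZ k (f : measurableTypeR R -> R) : bdd_supp (fun x : measurableTypeR R => `|x|) f ->
    (\int[lebesgue_measure]_x (k * f x)%:E = (k * \int[lebesgue_measure]_x f x)%:E)%E.
  move=> bf; under eq_integral do rewrite EFinM.
  rewrite integralZl//; last exact: int.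
  by rewrite EFinM fineK//; apply: integrable_fin_num => //; exact: int.
rewrite !eZ// -EFinM -EFinD lee_fin => UVW.
set U := \int[lebesgue_measure]_x u x in UVW *.
set V := \int[lebesgue_measure]_x v x in UVW *.
set W := \int[lebesgue_measure]_x w x in UVW W0 *.
have U0 : 0 <= U by apply: Rintegral_ge0 => x _; case: (uK x) => /andP[].
have V0 : 0 <= V by apply: Rintegral_ge0 => x _; case: (vK x) => /andP[].
rewrite -(ler_pM2l (_ : 0 < D^-1)) ?invr_gt0//; apply: le_trans UVW.
have s1' : 0 < 1 - s by rewrite subr_gt0.
(* The divisions by [1 - s] and [s] cancel the weights of the mean, leaving the sum in [UVW]; on the
   geometric side they leave [pl_cst s c]. *)
have := @weighted_am_gm R s (A^-1 * U / (1 - s)) (c * (B^-1 * V) / s) s01.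
rewrite !divr_ge0 ?(mulr_ge0, ltW iA, ltW iB, ltW c0, ltW s0, ltW s1')//.
move=> /(_ isT isT); congr (_ <= _); last first.
  by field; rewrite !gt_eqF.
rewrite (_ : c * (B^-1 * V) / s = B^-1 * (c / s) * V); last by ring.
rewrite (_ : A^-1 * U / (1 - s) = A^-1 * (1 - s)^-1 * U); last by ring.
have cs : 0 <= c / s by rewrite divr_ge0 ?ltW.
rewrite /pl_cst /D.
rewrite !powRM ?(mulr_ge0, invr_ge0, ltW Ap, ltW Bp, ltW s1', ltW c0, ltW s0)//.
by rewrite !Vpow ?ltW// powRN invfM; ring.
Qed.

(** * The Prekopa-Leindler inequality on [R^n] *)

Lemma rV_norm_leP (R : realType) n (x : 'rV[R]_n) (K : R) : 0 <= K ->
  (`|x| <= K) <-> (forall i, `|x ord0 i| <= K).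
Proof.
move=> K0; rewrite -[`|x|]/(mx_norm x) mx_normrE; split.
  move=> h i; apply: le_trans h; apply/bigmax_geP; right => /=.
  by exists (ord0, i).
by move=> h; apply/bigmax_leP; split=> // -[i j] _ /=; rewrite (ord1 i).
Qed.

Lemma rV_coord_le_norm (R : realType) n (x : 'rV[R]_n) i : `|x ord0 i| <= `|x|.
Proof. by move: i; apply/rV_norm_leP. Qed.

(* [f] is the pointwise limit of its compositions with the roundings of the
   coordinates to multiples of [1 / (k + 1)], which have countable range. *)
Lemma continuous_rV_measurable (R : realType) n (f : 'rV[R]_n -> R) :
  continuous f -> measurable_fun setT f.
Proof.
move=> cf.
pose r (k : nat) (m : 'rV[int]_n) : 'rV[R]_n := \row_i ((m ord0 i)%:~R / k.+1%:R).
pose z (k : nat) (x : 'rV[R]_n) : 'rV[int]_n := \row_i Num.floor (x ord0 i * k.+1%:R).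
apply: (@measurable_fun_cvg _ _ _ _ (fun k x => f (r k (z k x)))).
  move=> k _ B mB; rewrite setTI.
  rewrite (_ : _ @^-1` _ = \bigcup_(m : 'rV[int]_n)
      (if `[< B (f (r k m)) >] then [set x | z k x = m] else set0)); last first.
    apply/seteqP; split => x /=.
      by move=> h; exists (z k x) => //; rewrite asboolT.
    by move=> [m _]; case: asboolP => // h /= ->.
  apply: countable_bigcupT_measurable; first exact: countableP.
  move=> m; case: ifP => _; last exact: measurable0.
  have -> : [set x | z k x = m] = [set x : 'rV[R]_n | forall i, [set t : R |
     (m ord0 i)%:~R <= t * k.+1%:R < (m ord0 i + 1)%:~R] (x ord0 i)].
    apply/seteqP; split => x /=.
      by move=> <- i; rewrite mxE; exact: floor_itv.
    by move=> h; apply/rowP => i; rewrite mxE; exact/floor_def/h.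
  apply: (@measurable_box R n (fun i => [set t : R |
     (m ord0 i)%:~R <= t * k.+1%:R < (m ord0 i + 1)%:~R])) => i.
  have -> : [set t : R | (m ord0 i)%:~R <= t * k.+1%:R < (m ord0 i + 1)%:~R] =
      [set` `[(m ord0 i)%:~R / k.+1%:R, (m ord0 i + 1)%:~R / k.+1%:R[ ].
    by apply/seteqP; split => t /=; rewrite in_itv/= ler_pdivrMr// ltr_pdivlMr.
  exact: measurable_itv.
move=> x _; apply: cvg_comp; last exact: cf.
apply/cvgrPdist_lt => e e0.
near=> k.
apply: (@le_lt_trans _ _ k.+1%:R^-1); last first.
  by near: k; exact: near_infty_natSinv_lt (PosNum e0).
apply/rV_norm_leP => // i; rewrite !mxE.
have k0 : 0 < k.+1%:R :> R by [].
rewrite -[X in `|X - _|](mulfK (lt0r_neq0 k0)) -mulrBl normrM.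
rewrite [X in _ * X]ger0_norm ?invr_ge0// ler_piMl ?invr_ge0//.
have /andP[h1 h2] := floor_itv (x ord0 i * k.+1%:R).
rewrite ger0_norm ?subr_ge0// lerBlDr addrC; apply: ltW.
by rewrite intrD in h2.
Unshelve. all: by end_near. Qed.

Lemma rV_norm_measurable (R : realType) n :
  measurable_fun setT (fun x : 'rV[R]_n => `|x|).
Proof. by apply: continuous_rV_measurable; exact: norm_continuous. Qed.

Lemma lebesgue_rV_norm_le (R : realType) n (K : R) : 0 <= K ->
  lebesgue_rV n [set x : 'rV[R]_n | `|x| <= K] = ((K *+ 2) ^+ n)%:E.
Proof.
move=> K0.
have -> : [set x : 'rV[R]_n | `|x| <= K] =
    [set x | forall i, `[- K, K]%classic (x ord0 i)].
  apply/seteqP; split => x /=.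
    by move=> /(rV_norm_leP _ K0) h i; have := h i; rewrite in_itv/= ler_norml.
  by move=> h; apply/rV_norm_leP => // i; have := h i; rewrite in_itv/= ler_norml.
rewrite (@lebesgue_rV_box R n (fun=> `[- K, K]%classic)) => [|i]; last first.
  exact: measurable_itv.
under eq_bigr do rewrite lebesgue_measure_itv/=.
rewrite -[in RHS](card_ord n) -prodr_const -prodEFin; apply: eq_bigr => i _.
rewrite lte_fin; case: ltP => h.
  by rewrite -EFinB opprK -mulr2n.
rewrite (_ : K = 0) ?mul0rn//; apply/eqP; rewrite eq_le K0 andbT; lra.
Qed.

Lemma lebesgue_rV_norm_le_lty (R : realType) n (K : R) :
  (lebesgue_rV n [set x : 'rV[R]_n | (`|x| <= K)%R] < +oo)%E.
Proof.
have [K0|K0] := leP 0 K; first by rewrite lebesgue_rV_norm_le// ltry.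
have -> : [set x : 'rV[R]_n | `|x| <= K] = set0; last by rewrite measure0.
apply/seteqP; split => x //=.
by move=> /(le_trans (normr_ge0 _)); rewrite leNgt K0.
Qed.

Lemma measurable_norm_le (R : realType) n (K : R) :
  measurable [set x : 'rV[R]_n | `|x| <= K].
Proof.
have : measurable_fun setT (fun x : 'rV[R]_n => `|x| <= K).
  by apply: measurable_fun_ler => //; exact: rV_norm_measurable.
by move=> /(_ measurableT [set true]); rewrite setTI; exact.
Qed.

Lemma cons_rV_norm_le (R : realType) n (a : R) (x : 'rV[R]_n) :
  `|a| <= `|cons_rV (a, x)| /\ `|x| <= `|cons_rV (a, x)|.
Proof.
split; first by have := rV_coord_le_norm (cons_rV (a, x)) ord0; rewrite cons_rV0.
apply/rV_norm_leP => // i.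
by have := rV_coord_le_norm (cons_rV (a, x)) (lift ord0 i); rewrite cons_rVS.
Qed.

Lemma integral_lebesgue_rVS (R : realType) n (f : 'rV[R]_n.+1 -> \bar R) :
  measurable_fun setT f -> (forall x, (0 <= f x)%E) ->
  (\int[lebesgue_rV n.+1]_x f x =
   \int[lebesgue_measure]_a \int[lebesgue_rV n]_x f (cons_rV (a, x)))%E.
Proof.
move=> mf f0.
rewrite -(@fubini_tonelli1 _ _ _ _ R lebesgue_measure (lebesgue_rV n)
  (fun p : measurableTypeR R * 'rV[R]_n => f (cons_rV p))) => [||p]; last first.
- exact: f0.
- by apply: measurableT_comp => //; exact: measurable_cons_rV.
have mc : measurable_fun [set: measurableTypeR R * 'rV[R]_n] (@cons_rV R n).
  exact: measurable_cons_rV.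
have := @ge0_integral_pushforward _ _ _ _ R _ mc
  (lebesgue_measure \x lebesgue_rV n)%E setT f measurableT mf (fun x _ => f0 x).
rewrite preimage_setT => <-.
exact: eq_measure_integral.
Qed.

Lemma bdd_supp_rV_integrable (R : realType) n (f : 'rV[R]_n -> R) :
  bdd_supp (fun x : 'rV[R]_n => `|x|) f ->
  (lebesgue_rV n).-integrable setT (EFin \o f).
Proof.
apply: bdd_supp_integrable; first exact: rV_norm_measurable.
exact: lebesgue_rV_norm_le_lty.
Qed.

Lemma bdd_suppZ d (T : measurableType d) (R : realType) (N f : T -> R) k :
  0 <= k -> bdd_supp N f -> bdd_supp N (fun x => k * f x).
Proof.
move=> k0 [mf [K fK]]; split; first exact: measurable_funM.
exists (Num.max K (k * K)) => x; have [/andP[f0 fk] f0'] := fK x.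
rewrite mulr_ge0//= le_max ler_wpM2l// orbT; split=> //.
by rewrite gt_max => /andP[/f0' ->]; rewrite mulr0.
Qed.

Lemma bdd_supp_section (R : realType) n (f : 'rV[R]_n.+1 -> R) (a : R) :
  bdd_supp (fun x : 'rV[R]_n.+1 => `|x|) f ->
  bdd_supp (fun x : 'rV[R]_n => `|x|) (fun x => f (cons_rV (a, x))).
Proof.
move=> [mf [K fK]]; split.
  apply: (@measurable_fun_pair2 _ _ _ _ _ _ (fun p => f (cons_rV p)) a).
  by apply: measurableT_comp => //; exact: measurable_cons_rV.
exists K => x; have [-> nf] := fK (cons_rV (a, x)); split=> // Kx.
by apply: nf; apply: lt_le_trans Kx _; case: (cons_rV_norm_le a x).
Qed.

(** The stability that carries the induction on the dimension: a fiber integral only sees a cube of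
    finite volume, and it vanishes when the first coordinate alone leaves the support. *)
Lemma bdd_supp_marginal (R : realType) n (f : 'rV[R]_n.+1 -> R) :
  bdd_supp (fun x : 'rV[R]_n.+1 => `|x|) f ->
  bdd_supp (fun a : measurableTypeR R => `|a|)
    (fun a => \int[lebesgue_rV n]_x f (cons_rV (a, x))) /\
  \int[lebesgue_rV n.+1]_x f x =
    \int[lebesgue_measure]_a \int[lebesgue_rV n]_x f (cons_rV (a, x)).
Proof.
move=> bf; have [mf [K fK]] := bf.
have f0 x : 0 <= f x by case: (fK x) => /andP[].
have mfc : measurable_fun setT
    (fun p : measurableTypeR R * 'rV[R]_n => (f (cons_rV p))%:E).
  apply/measurable_EFinP; apply: measurableT_comp => //.
  exact: measurable_cons_rV.
have mF := @measurable_fun_fubini_tonelli_F _ _ _ _ R (lebesgue_rV n) _ mfc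
  (fun p => f0 _).
have int a : (lebesgue_rV n).-integrable setT (EFin \o (fun x => f (cons_rV (a, x)))).
  by apply: bdd_supp_rV_integrable; exact: bdd_supp_section.
split; last first.
  rewrite /Rintegral integral_lebesgue_rVS//; last exact/measurable_EFinP.
  congr fine; apply: eq_integral => a _.
  by rewrite fineK//; apply: integrable_fin_num => //; exact: int.
split; first by apply: measurableT_comp mF; exact: fine_measurable.
pose B := [set x : 'rV[R]_n | `|x| <= K].
have mB : measurable B by exact: measurable_norm_le.
(* The radius of the support, or the bound [K] times the volume of the cube, whichever is larger. *)
exists (Num.max K (fine (\int[lebesgue_rV n]_(x in B) (K%:E))%E)) => a.
split; last first.
  rewrite gt_max => /andP[Ka _]; rewrite (_ : (fun _ => _) = cst 0).
    by rewrite Rintegral_cst// mul0r.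
  apply/funext => x; case: (fK (cons_rV (a, x))) => _; apply.
  by apply: lt_le_trans Ka _; case: (cons_rV_norm_le a x).
rewrite Rintegral_ge0//= le_max; apply/orP; right.
rewrite /Rintegral.
have -> : (\int[lebesgue_rV n]_x (f (cons_rV (a, x)))%:E =
           \int[lebesgue_rV n]_(x in B) (f (cons_rV (a, x)))%:E)%E.
  rewrite [RHS]integral_mkcond; apply: eq_integral => x _; rewrite patchE.
  case: ifPn => //; rewrite notin_setE /B /= => /negP; rewrite -ltNge => Kx.
  case: (fK (cons_rV (a, x))) => _ ->//.
  by apply: lt_le_trans Kx _; case: (cons_rV_norm_le a x).
rewrite fine_le//.
- by apply: integrable_fin_num => //; apply: integrableS (int a).
- rewrite integral_cst// fin_numM// ge0_fin_numE//.
  exact: lebesgue_rV_norm_le_lty.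
- apply: ge0_le_integral => //.
  + by move=> x _; rewrite lee_fin.
  + by apply: (measurable_funS measurableT) => //; apply: measurable_int (int a).
  + by move=> x _; rewrite lee_fin; case: (fK (cons_rV (a, x))) => /andP[].
Qed.

Lemma cons_rV_linear (R : realType) n (a b c : R) (x y : 'rV[R]_n) :
  cons_rV (a + c * b, x + c *: y) = cons_rV (a, x) + c *: cons_rV (b, y).
Proof.
apply/rowP => i; case: (unliftP ord0 i) => [j|] ->.
  by rewrite cons_rVS [RHS]mxE [X in _ = _ + X]mxE !cons_rVS !mxE.
by rewrite cons_rV0 [RHS]mxE [X in _ = _ + X]mxE !cons_rV0.
Qed.

Lemma pl_cst_gt0 (R : realType) (s c : R) : 0 < s < 1 -> 0 < c -> 0 < pl_cst s c.
Proof.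
by move=> /andP[s0 s1] c0; rewrite mulr_gt0// powR_gt0 ?subr_gt0// divr_gt0.
Qed.

(** For fixed first coordinates the induction hypothesis on the fibers is the one-dimensional
    hypothesis for the marginals, up to the constant [pl_cst s c ^+ n]; each coordinate contributes
    one factor. *)
Lemma prekopa_leindler (R : realType) n (u v w : 'rV[R]_n -> R) (s c : R) :
  0 < s < 1 -> 0 < c ->
  bdd_supp (fun x : 'rV[R]_n => `|x|) u -> bdd_supp (fun x : 'rV[R]_n => `|x|) v ->
  bdd_supp (fun x : 'rV[R]_n => `|x|) w ->
  (forall x y, u x `^ (1 - s) * v y `^ s <= w (x + c *: y)) ->
  pl_cst s c ^+ n * (\int[lebesgue_rV n]_x u x) `^ (1 - s) *
    (\int[lebesgue_rV n]_x v x) `^ s <= \int[lebesgue_rV n]_x w x.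
Proof.
move=> s01 c0; elim: n u v w => [|n IH] u v w bu bv bw uvw.
  have int0 (f : 'rV[R]_0 -> R) : measurable_fun setT f ->
      \int[lebesgue_rV 0]_x f x = f 0.
    move=> mf; have mf' : measurable_fun setT (EFin \o f) by exact/measurable_EFinP.
    have := @integral_dirac _ _ (0 : 'rV[R]_0) R setT measurableT _ mf'.
    by rewrite /Rintegral diracT mul1e => ->.
  rewrite !int0 ?expr0 ?mul1r; [|by case: bw|by case: bv|by case: bu].
  by have := uvw 0 0; rewrite scaler0 addr0.
have [bU ->] := bdd_supp_marginal bu; have [bV ->] := bdd_supp_marginal bv.
have [bW ->] := bdd_supp_marginal bw.
have k0 : 0 < pl_cst s c ^+ n by rewrite exprn_gt0// pl_cst_gt0.
have k0' : 0 <= (pl_cst s c ^+ n)^-1 by rewrite invr_ge0 ltW.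
(* The constant of the fibers is moved onto the marginal of [w], so that the one-dimensional
   hypothesis holds without a constant. *)
have h := prekopa_leindler_R s01 c0 bU bV (bdd_suppZ k0' bW).
move: h; rewrite RintegralZl//; last exact: bdd_supp_R_integrable.
rewrite ler_pdivlMl// exprSr [_ * pl_cst s c]mulrC => h.
rewrite [pl_cst s c * _]mulrC -!mulrA; move: h; rewrite -!mulrA; apply=> x y.
rewrite ler_pdivlMl// mulrA; apply: IH; try exact: bdd_supp_section.
by move=> x' y'; rewrite cons_rV_linear.
Qed.

(** * First-order expansions *)

(** The norms are sup norms, whence the factor [n]. *)
Lemma dot_le (R : realType) n (a b : 'rV[R]_n) :
  `|dot a b| <= n%:R * (`|a| * `|b|).
Proof.
rewrite /dot; apply: le_trans (ler_norm_sum _ _ _) _.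
rewrite mulr_natl -[X in _ *+ X](card_ord n) -sumr_const.
by apply: ler_sum => i _; rewrite normrM ler_pM// rV_coord_le_norm.
Qed.

Lemma dotBl (R : realType) n (a b c : 'rV[R]_n) : dot (a - b) c = dot a c - dot b c.
Proof. by rewrite /dot -sumrB; apply: eq_bigr => i _; rewrite !mxE mulrBl. Qed.

Lemma dotZr (R : realType) n (k : R) (a b : 'rV[R]_n) : dot a (k *: b) = k * dot a b.
Proof. by rewrite /dot mulr_sumr; apply: eq_bigr => i _; rewrite mxE mulrCA. Qed.

Lemma dotNr (R : realType) n (a b : 'rV[R]_n) : dot a (- b) = - dot a b.
Proof. by rewrite -scaleN1r dotZr mulN1r. Qed.

Lemma dotNl (R : realType) n (a b : 'rV[R]_n) : dot (- a) b = - dot a b.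
Proof. by rewrite -[- a]add0r dotBl {1}/dot big1 ?sub0r// => i _; rewrite mxE mul0r. Qed.

Lemma derive_dot (R : realType) n (g : 'rV[R]_n -> R) (p v : 'rV[R]_n) :
  differentiable g p -> 'D_v g p = dot (grad g p) v.
Proof.
move=> dg; rewrite deriveE// {1}(row_sum_delta v) linear_sum /dot.
by apply: eq_bigr => i _; rewrite linearZ mxE deriveE// mulrC.
Qed.

Lemma rV_mean_value (R : realType) n (g : 'rV[R]_n -> R) (x v : 'rV[R]_n) :
  (forall p, differentiable g p) ->
  exists2 t : R, 0 < t < 1 & g (x + v) - g x = dot (grad g (x + t *: v)) v.
Proof.
move=> dg.
have dphi (t : R) : is_derive t (1 : R) (fun t : R => g (x + t *: v))
    (dot (grad g (x + t *: v)) v).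
  have E : (fun h : R => h^-1 *: (((fun t : R => g (x + t *: v)) \o shift t) (h *: 1)
      - g (x + t *: v))) =
      (fun h : R => h^-1 *: ((g \o shift (x + t *: v)) (h *: v) - g (x + t *: v))).
    apply/funext => h /=; congr (_ *: (g _ - _)).
    by rewrite scaler1 scalerDl addrCA.
  apply: DeriveDef.
    by rewrite /derivable E; exact: diff_derivable.
  by rewrite /derive E; exact: derive_dot.
have [|t t01] := @MVT R (fun t => g (x + t *: v)) _ 0 1 ltr01 (fun t _ => dphi t).
  apply: continuous_subspaceT => t; apply: differentiable_continuous.
  by apply/derivable1_diffP; case: (dphi t).
rewrite scale1r scale0r addr0 subr0 mulr1 => ->.
by exists t => //; move: t01; rewrite in_itv.
Qed.

(** * Uniform estimates on cubes *)

Lemma rV_ball_compact (R : realType) n (r : R) :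
  compact [set x : 'rV[R]_n | `|x| <= r].
Proof.
apply: bounded_closed_compact.
  exists r; split; first exact: num_real.
  by move=> y ry x /= xr; apply: le_trans xr (ltW ry).
rewrite (_ : mkset _ = Num.norm @^-1` [set t | t <= r])//.
by apply: preimage_closed => [x _|]; [exact: norm_continuous|exact: closed_le].
Qed.

Lemma rV_ball_bounded (R : realType) n (f : 'rV[R]_n -> R) (r : R) :
  continuous f -> exists2 B, 0 < B & forall x, `|x| <= r -> `|f x| <= B.
Proof.
move=> cf; have [r0|r0] := ltP r 0.
  exists 1 => // x /(le_trans (normr_ge0 _)).
  by rewrite leNgt r0.
have [|||c _ fc] := @EVT_max_rV R n (fun x => `|f x|) [set x | `|x| <= r].
- by exists 0; rewrite /= normr0.
- exact: rV_ball_compact.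
- apply: continuous_subspaceT => x.
  by apply: continuous_comp; [exact: cf|exact: norm_continuous].
exists (`|f c| + 1); first by rewrite ltr_wpDl.
by move=> x xr; apply: le_trans (fc x _) _; rewrite ?inE// lerDl.
Qed.

(** Only [x] is confined to the ball and [z] may leave it, so compactness is used in its covering
    form, with the distance [d] as the parameter tending to 0 from the right. *)
Lemma rV_uniformly_continuous_ball (R : realType) n (F : 'rV[R]_n -> 'rV[R]_n)
    (r e : R) : continuous F -> 0 < e ->
  exists2 d, 0 < d & forall x z, `|x| <= r -> `|z - x| < d -> `|F z - F x| < e.
Proof.
move=> cF e0.
have := (compact_near_coveringP _).1 (@rV_ball_compact R n r) R (0 : R)^'+
  (fun d x => forall z, `|z - x| < d -> `|F z - F x| < e) _.
case.
  move=> x _.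
  have e2 : 0 < e / 2 by rewrite divr_gt0.
  have /cvgrPdist_lt /(_ _ e2) /nbhs_ballP[eta /= eta0 xeta] := cF x.
  have eta2 : 0 < eta / 2 by rewrite divr_gt0.
  exists (ball x (eta / 2), [set d | 0 < d < eta / 2]) => /=.
    split; first exact: nbhsx_ballx.
    near=> d; apply/andP; split; first by near: d; exact: nbhs_right_gt.
    by near: d; exact: nbhs_right_lt.
  move=> [y d] /= [xy /andP[d0 deta]] z zy.
  have h1 : `|F x - F y| < e / 2.
    by apply: xeta; apply: le_ball xy; rewrite ler_pdivrMr// ler_peMr// ?ler1n// ltW.
  have h2 : `|F x - F z| < e / 2.
    apply: xeta; move: xy; rewrite -!ball_normE/= => xy.
    rewrite (_ : x - z = (x - y) - (z - y)); last by rewrite opprB subrKA.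
    apply: le_lt_trans (ler_normB _ _) _.
    by rewrite (splitr eta) ltrD// (lt_trans zy).
  rewrite (_ : F z - F y = (F x - F y) - (F x - F z)); last first.
    by rewrite opprB [RHS]addrC subrKA.
  by apply: le_lt_trans (ler_normB _ _) _; rewrite (splitr e) ltrD.
(* The property holds for every parameter in $(0,d)$; its midpoint is taken. *)
move=> d /= d0 dP; exists (d / 2); first by rewrite divr_gt0.
move=> x z xr zx; apply: (dP (d / 2)) => //=.
  by rewrite sub0r normrN gtr0_norm ?divr_gt0// ltr_pdivrMr// ltr_pMr// ltr1n.
by rewrite divr_gt0.
Unshelve. all: by end_near. Qed.

Lemma class_C1_uniform_diff (R : realType) n (g : 'rV[R]_n -> R) (r e : R) :
  class_C1 g -> 0 < e ->
  exists2 d, 0 < d & forall x v, `|x| <= r -> `|v| < d ->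
    `|g (x + v) - g x - dot (grad g x) v| <= e * `|v|.
Proof.
move=> [dg cg] e0.
(* The mean value theorem and [dot_le] lose a factor [n]; dividing by [n.+1] absorbs it and stays
   meaningful for [n = 0]. *)
have e0' : 0 < e / n.+1%:R by rewrite divr_gt0.
have [d d0 dP] := rV_uniformly_continuous_ball r cg e0'.
exists d => // x v xr vd; have [t /andP[t0 t1] ->] := rV_mean_value x v dg.
rewrite -dotBl; apply: le_trans (dot_le _ _) _; rewrite mulrA ler_wpM2r//.
have : `|grad g (x + t *: v) - grad g x| < e / n.+1%:R.
  apply: dP => //; rewrite addrC addKr normrZ gtr0_norm//.
  by apply: le_lt_trans vd; rewrite ler_piMl// ltW.
move=> /ltW h; apply: le_trans (ler_wpM2l (ler0n _ _) h) _.
by rewrite mulrCA ler_piMr ?(ltW e0)// ler_pdivrMr// mul1r ler_nat.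
Qed.

(* Otherwise [psi] would grow at least linearly beyond [N]. *)
Lemma bounded_monotone_small_growth (R : realType) (psi : R -> R) (Z e N : R) :
  {homo psi : x y / x <= y} -> (forall r, psi r <= Z) -> 0 < e ->
  exists2 r, N <= r &
    exists2 d, 0 < d & forall h, 0 < h < d -> psi (r + h) - psi r <= e * h.
Proof.
move=> mpsi psiZ e0; apply: contrapT => H.
have {}H r d : N <= r -> 0 < d -> exists2 h, 0 < h < d & e * h < psi (r + h) - psi r.
  move=> Nr d0; apply: contrapT => H'; apply: H; exists r => //; exists d => // h hd.
  by rewrite leNgt; apply/negP => hh; apply: H'; exists h.
pose A := [set t | N <= t /\ e * (t - N) <= psi t - psi N].
have AN : A N by split; rewrite ?subrr ?mulr0.
have supA : has_sup A.
  split; first by exists N.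
  exists ((Z - psi N) / e + N) => t [_ h].
  rewrite -lerBlDr ler_pdivlMr// mulrC (le_trans h)// lerD2r.
  exact: psiZ.
pose T := sup A.
have TA t : A t -> t <= T by move=> At; apply: ub_le_sup => //; case: supA.
(* Monotonicity puts the supremum itself in [A]: the increase of [psi] up to any [t] in [A] is at
   most its increase up to [T]. The failure of the claim at [T] then produces a point of [A] beyond
   [T]. *)
have AT : A T.
  split; first exact: TA.
  rewrite mulrC -ler_pdivlMr// lerBlDr; apply: ge_sup; first by exists N.
  move=> t At; have tT := TA _ At; case: At => _ h.
  rewrite -lerBlDr ler_pdivlMr// mulrC (le_trans h)// lerD2r.
  exact: mpsi.
have [h /andP[h0 _] hT] := H T 1 AT.1 ltr01.
suff /TA : A (T + h) by rewrite gerDl leNgt h0.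
case: AT => NT AT; split; first by rewrite (le_trans NT)// lerDl ltW.
by rewrite addrAC mulrDr; lra.
Qed.

(** Follows from $e^t \le 1/(1-t)$ and $(1+t+2t^2)(1-t) = 1 + t^2(1-2t) \ge 1$. *)
Lemma expR_le_quadratic (R : realType) (t : R) : t <= 2^-1 ->
  expR t <= 1 + t + 2 * t ^+ 2.
Proof.
move=> t2.
have h : 1 - t <= expR (- t) by have := expR_ge1Dx (- t).
have h1 : 0 < 1 - t by lra.
apply: (@le_trans _ _ (1 - t)^-1).
  by rewrite -[expR t]invrK -expRN lef_pV2 ?posrE ?expR_gt0.
rewrite -[leLHS]mul1r ler_pdivrMr//.
have : 0 <= t ^+ 2 * (1 - 2 * t) by rewrite mulr_ge0 ?sqr_ge0//; lra.
have -> : (1 + t + 2 * t ^+ 2) * (1 - t) = 1 + t ^+ 2 * (1 - 2 * t) by ring.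
by rewrite lerDl.
Qed.

(** * Truncation to cubes and Prekopa-Leindler to first order *)

Definition cut (R : realType) n (r : R) (f : 'rV[R]_n -> R) (x : 'rV[R]_n) : R :=
  if `|x| <= r then f x else 0.

Lemma measurable_cut (R : realType) n (r : R) (f : 'rV[R]_n -> R) :
  measurable_fun setT f -> measurable_fun setT (cut r f).
Proof.
move=> mf; rewrite (_ : cut r f = fun x => f x * \1_[set x | `|x| <= r] x).
  apply: measurable_funM => //; apply: measurable_indic.
  exact: measurable_norm_le.
apply/funext => x; rewrite /cut indicE.
by case: ifP => h; [rewrite mem_set ?mulr1|rewrite memNset ?mulr0//= h].
Qed.

Lemma cut_bdd_supp (R : realType) n (r B : R) (f : 'rV[R]_n -> R) : 0 <= B ->
  measurable_fun setT f -> (forall x, `|x| <= r -> 0 <= f x <= B) ->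
  bdd_supp (fun x : 'rV[R]_n => `|x|) (cut r f).
Proof.
move=> B0 mf fB; split; first exact: measurable_cut.
exists (Num.max r B) => x; rewrite /cut; case: ifP => xr.
  case/andP: (fB x xr) => -> fb; rewrite le_max fb orbT; split=> //.
  by rewrite gt_max ltNge xr.
by rewrite lexx le_max B0 orbT; split.
Qed.

Lemma cut_integrable (R : realType) n (r B : R) (f : 'rV[R]_n -> R) :
  measurable_fun setT f -> (forall x, `|x| <= r -> `|f x| <= B) ->
  (lebesgue_rV n).-integrable setT (EFin \o cut r f).
Proof.
move=> mf fB.
apply: (@le_integrable _ _ _ _ _ _ _ (EFin \o cut r (fun=> `|B|))) => //.
- by apply/measurable_EFinP; exact: measurable_cut.
- move=> x _ /=; rewrite lee_fin /cut; case: ifP => // /fB h.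
  by rewrite normr_id (le_trans h)// ler_norm.
- apply: bdd_supp_rV_integrable; apply: (@cut_bdd_supp _ _ _ `|B|) => // x _.
  by rewrite normr_ge0 lexx.
Qed.

Lemma Rintegral_cut_cst (R : realType) n (r k : R) : 0 <= r ->
  \int[lebesgue_rV n]_x cut r (fun=> k) x = k * (r *+ 2) ^+ n.
Proof.
move=> r0.
have -> : cut r (fun=> k) = (fun=> k) \_ [set x : 'rV[R]_n | `|x| <= r].
  apply/funext => x; rewrite /cut patchE; have [h|h] := boolP (`|x| <= r).
    by rewrite mem_set.
  by rewrite memNset//=; exact/negP.
have mB := @measurable_norm_le R n r.
by rewrite -Rintegral_mkcond Rintegral_cst//= lebesgue_rV_norm_le.
Qed.

Lemma Rintegral_cut_expR_gt0 (R : realType) n (r : R) (f : 'rV[R]_n -> R) :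
  continuous f -> 0 < r -> 0 < \int[lebesgue_rV n]_x cut r (fun x => expR (f x)) x.
Proof.
move=> cf r0; have [B B0 fB] := rV_ball_bounded r cf.
have mf : measurable_fun setT (fun x => expR (f x)).
  by apply: measurableT_comp => //; exact: continuous_rV_measurable.
apply: (@lt_le_trans _ _ (\int[lebesgue_rV n]_x cut r (fun=> expR (- B)) x)).
  by rewrite Rintegral_cut_cst ?(ltW r0)// mulr_gt0 ?expR_gt0// exprn_gt0// mulrn_wgt0.
apply: le_Rintegral => //.
- by apply: (@cut_integrable _ _ _ (expR (- B))) => // x _; rewrite ger0_norm ?expR_ge0.
- apply: (@cut_integrable _ _ _ (expR B)) => // x /fB h.
  rewrite ger0_norm ?expR_ge0// ler_expR.
  by move: h; rewrite ler_norml => /andP[].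
- move=> x _; rewrite /cut; case: ifP => // /fB.
  by rewrite ler_norml ler_expR => /andP[].
Qed.

Lemma Rintegral_lin3 d (T : measurableType d) (R : realType)
    (mu : {measure set T -> \bar R}) (f g h : T -> R) (a b c : R) :
  mu.-integrable setT (EFin \o f) -> mu.-integrable setT (EFin \o g) ->
  mu.-integrable setT (EFin \o h) ->
  mu.-integrable setT (EFin \o (fun x => a * f x + b * g x + c * h x)) /\
  \int[mu]_x (a * f x + b * g x + c * h x) =
    a * \int[mu]_x f x + b * \int[mu]_x g x + c * \int[mu]_x h x.
Proof.
move=> jf jg jh.
have Z k (F : T -> R) : mu.-integrable setT (EFin \o F) ->
    mu.-integrable setT (EFin \o (fun x => k * F x)).
  move=> jF; rewrite (_ : _ \o _ = fun x => (k%:E * (EFin \o F) x)%E).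
    exact: integrableZl.
  by apply/funext => x /=; rewrite EFinM.
have D (F G : T -> R) : mu.-integrable setT (EFin \o F) ->
    mu.-integrable setT (EFin \o G) ->
    mu.-integrable setT (EFin \o (fun x => F x + G x)).
  move=> jF jG; rewrite (_ : _ \o _ = ((EFin \o F) \+ (EFin \o G))%E) //.
  exact: integrableD.
have jab := D _ _ (Z a _ jf) (Z b _ jg).
split; first exact: D _ _ jab (Z c _ jh).
rewrite (RintegralD _ jab (Z c _ jh))// (RintegralD _ (Z a _ jf) (Z b _ jg))//.
by rewrite !RintegralZl.
Qed.

Lemma ln_pl_cst (R : realType) (s k : R) : 0 < s < 1 -> 0 < k ->
  ln (pl_cst s (k * s)) = - (1 - s) * ln (1 - s) + s * ln k.
Proof.
move=> /andP[s0 s1] k0; rewrite /pl_cst mulfK ?gt_eqF//.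
by rewrite lnM ?posrE ?powR_gt0 ?subr_gt0// !ln_powR.
Qed.

(* First-order expansion in [s] of the left-hand side of Prekopa-Leindler. *)
Lemma pl_lhs_ge (R : realType) n (s k P L : R) : 0 < s < 1 -> 0 < k -> 0 < P -> 0 < L ->
  P + s * (P * (n%:R * ln k + n%:R * (1 - s) + ln L - ln P)) <=
  pl_cst s (k * s) ^+ n * P `^ (1 - s) * L `^ s.
Proof.
move=> s01 k0 P0 L0; have /andP[s0 s1] := s01.
have ks0 : 0 < k * s by rewrite mulr_gt0.
have c0 := pl_cst_gt0 s01 ks0.
have s1' : 0 < 1 - s by rewrite subr_gt0.
set X := leRHS; have X0 : 0 < X by rewrite !mulr_gt0 ?powR_gt0// exprn_gt0.
have lnX : ln X = ln P + (s * (n%:R * ln k + ln L - ln P) - n%:R * (1 - s) * ln (1 - s)).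
  rewrite /X !lnM ?posrE ?mulr_gt0 ?powR_gt0 ?exprn_gt0// lnXn// !ln_powR ln_pl_cst//.
  by rewrite -mulr_natl; ring.
rewrite -[X]lnK ?posrE// lnX expRD lnK ?posrE//.
rewrite [leLHS](_ : _ =
  P * (1 + s * (n%:R * ln k + n%:R * (1 - s) + ln L - ln P))); last by ring.
rewrite ler_wpM2l ?(ltW P0)//; apply: le_trans (expR_ge1Dx _).
(* After $e^t \ge 1 + t$, this bound turns $-n(1-s)\ln(1-s)$ into the term $ns(1-s)$. *)
have : ln (1 - s) <= - s by have := @le_ln1Dx R (- s); apply; lra.
have n1 : 0 <= n%:R * (1 - s) by rewrite mulr_ge0// ltW.
move=> /(ler_wpM2l n1); lra.
Qed.

(* Prekopa-Leindler for [e^g] on the ball of radius [r] and [e^-C] on the ball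
   of radius [M], to first order as [s] tends to [0]. *)
Lemma prekopa_leindler_first_order (R : realType) n (g C a : 'rV[R]_n -> R)
    (k M r e d0 B : R)
    (psi := fun t => \int[lebesgue_rV n]_x cut t (fun x => expR (g x)) x) :
  class_C1 g -> continuous C -> measurable_fun setT a ->
  0 < k -> 0 < M -> 0 < r -> 0 < e -> 0 < d0 ->
  (forall h, 0 < h < d0 -> psi (r + h) - psi r <= e * h) ->
  (forall x, `|x| <= r + 1 -> `|a x| <= B) ->
  (forall x y, `|x| <= r + 1 -> `|y| <= M -> - (k * dot (grad g x) y) - C y <= a x) ->
  psi r * (n%:R * ln k + n%:R +
     ln (\int[lebesgue_rV n]_x cut M (fun y => expR (- C y)) x) - ln (psi r)) <=
  e * (k * M) + \int[lebesgue_rV n]_x cut r (fun x => expR (g x) * (- g x + a x + e)) x.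
Proof.
move=> gC1 cC ma k0 M0 r0 e0 d0_gt0 shell aB ha.
have [dg cdg] := gC1.
have cg : continuous g by move=> x; exact: differentiable_continuous.
have mg := continuous_rV_measurable cg.
have mC := continuous_rV_measurable cC.
have [G G0 gG] := rV_ball_bounded (r + 1) cg.
have [G' G'0 gG'] : exists2 G', 0 < G' & forall x, `|x| <= r + 1 -> `|grad g x| <= G'.
  have cng : continuous (fun x => `|grad g x|).
    by move=> x; apply: continuous_comp; [exact: cdg|exact: norm_continuous].
  have [G' G'0 h] := rV_ball_bounded (r + 1) cng.
  by exists G' => // x /h; rewrite normr_id.
have [c c0 Cc] := rV_ball_bounded M cC.
have B0 : 0 <= B by apply: le_trans (aB 0 _); rewrite ?normr0// addr_ge0// ltW.
(* Displacements have norm at most [s * (k * M)], so the expansion of [g] with tolerance [e1] errs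
   by at most [s * (e / 2)]. *)
pose e1 := e / 2 / (k * M).
have kM0 : 0 < k * M by rewrite mulr_gt0.
have e10 : 0 < e1 by rewrite !divr_gt0.
have [d1 d10 gd1] := class_C1_uniform_diff (r + 1) gC1 e10.
pose f x := expR (g x).
have mf : measurable_fun setT f by exact: measurableT_comp.
have f0 x : 0 <= f x by exact: expR_ge0.
have fG x : `|x| <= r + 1 -> f x <= expR G.
  by move=> /gG; rewrite ler_norml ler_expR => /andP[].
pose b x := - g x + a x + e.
pose B' := G + B + e.
have B'0 : 0 < B' by rewrite addr_gt0// ltr_wpDr.
have bB x : `|x| <= r + 1 -> `|b x| <= B'.
  move=> xr; apply: le_trans (ler_normD _ _) _; rewrite [`|e|]gtr0_norm// lerD2r.
  by apply: le_trans (ler_normD _ _) _; rewrite normrN lerD// ?gG// aB.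
have mb : measurable_fun setT b.
  by apply: measurable_funD => //; apply: measurable_funD => //; exact: measurableT_comp.
set L := \int[_]_x cut M _ x; set I := \int[_]_x cut r _ x.
have P0 : 0 < psi r by exact: Rintegral_cut_expR_gt0.
have L0 : 0 < L.
  by apply: Rintegral_cut_expR_gt0 => // x; apply: continuousN; exact: cC.
(* The total coefficient of $s^2$ in the final inequality, made independent of [s] by bounding
   [e * h] by [e * d0]. It comes from the product of [s * B'] with the shell error, the quadratic
   term of the exponential, and [n * (1 - s)] replaced by [n]. *)
pose D := B' * (e * (k * M)) + 2 * B' ^+ 2 * (psi r + e * d0) + psi r * n%:R.
have D0 : 0 <= D.
  have Q0 : 0 <= psi r + e * d0 by exact: addr_ge0 (ltW P0) (mulr_ge0 (ltW e0) (ltW d0_gt0)).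
  apply: addr_ge0; last exact: mulr_ge0 (ltW P0) (ler0n _ _).
  apply: addr_ge0; first exact: mulr_ge0 (ltW B'0) (mulr_ge0 (ltW e0) (ltW kM0)).
  by apply: mulr_ge0 => //; rewrite mulr_ge0// sqr_ge0.
apply/ler_addgt0Pr => eta eta0.
(* [s * (k * Gs)] bounds the variation of [g] along a displacement: gradient term plus expansion
   error, with 1 added to keep [Gs] positive. *)
pose Gs := n%:R * (G' * M) + e1 * M + 1.
have Gs0 : 0 < Gs.
  have G'M : 0 <= G' * M by rewrite mulr_ge0// ltW.
  have e1M : 0 <= e1 * M by rewrite mulr_ge0// ltW.
  by rewrite ltr_wpDl// addr_ge0// mulr_ge0.
near (0 : R)^'+ => s.
have s0 : 0 < s by near: s; exact: nbhs_right_gt.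
have s1 : s < 1 by near: s; exact: nbhs_right_lt.
have sd0 : s * (k * M) < d0.
  by rewrite -ltr_pdivlMr//; near: s; apply: nbhs_right_lt; rewrite divr_gt0.
have sd1 : s * (k * M) < d1.
  by rewrite -ltr_pdivlMr//; near: s; apply: nbhs_right_lt; rewrite divr_gt0.
have sr1 : s * (k * M) < 1.
  by rewrite -ltr_pdivlMr//; near: s; apply: nbhs_right_lt; rewrite divr_gt0.
have sB : s * B' <= 2^-1.
  by rewrite -ler_pdivlMr// ltW//; near: s; apply: nbhs_right_lt; rewrite divr_gt0.
have sG : s * (k * Gs) <= e / 2.
  rewrite -ler_pdivlMr ?mulr_gt0// ltW//; near: s; apply: nbhs_right_lt.
  by rewrite !divr_gt0// mulr_gt0.
have sD : s * (D + 1) <= eta.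
  rewrite -ler_pdivlMr ?ltr_wpDl// ltW//; near: s; apply: nbhs_right_lt.
  by rewrite divr_gt0// ltr_wpDl.
have s01 : 0 < s < 1 by rewrite s0.
have ks0 : 0 < k * s by rewrite mulr_gt0.
pose h := s * (k * M).
have h0 : 0 < h by rewrite mulr_gt0.
have rh1 x : `|x| <= r + h -> `|x| <= r + 1.
  by move=> /le_trans; apply; rewrite lerD2l ltW.
have rrh x : `|x| <= r -> `|x| <= r + h by move=> /le_trans; apply; rewrite lerDl ltW.
pose w x := expR (g x + s * b x).
have mw : measurable_fun setT w.
  apply: measurableT_comp => //; apply: measurable_funD => //.
  exact: measurable_funM.
(* The expansion is made at the endpoint [z], because [a z] involves the gradient there. The slack
   [e] in [b] pays twice [e / 2]: for the expansion error, and for replacing [g x] by [g z] in the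
   term [- s * g x]. *)
have key x y : `|x| <= r -> `|y| <= M ->
    (1 - s) * g x - s * C y <= g (x + (k * s) *: y) + s * b (x + (k * s) *: y).
  move=> xr yM; set z := x + _.
  have nv : `|(k * s) *: y| <= h.
    by rewrite normrZ gtr0_norm// /h mulrCA -mulrA ler_pM2l// ler_pM2l.
  have zr : `|z| <= r + 1.
    by apply: rh1; apply: le_trans (ler_normD _ _) _; rewrite lerD.
  have := gd1 z (- ((k * s) *: y)) zr; rewrite normrN /z addrK -/z.
  move=> /(_ (le_lt_trans nv sd1)) hd.
  rewrite dotNr dotZr opprK in hd.
  have hv : e1 * `|(k * s) *: y| <= s * (e / 2).
    apply: le_trans (ler_wpM2l (ltW e10) nv) _.
    rewrite /e1 /h le_eqVlt; apply/orP; left; apply/eqP; field.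
    by rewrite !gt_eqF.
  have hdot : `|dot (grad g z) y| <= n%:R * (G' * M).
    apply: le_trans (dot_le _ _) _; rewrite ler_wpM2l//.
    by rewrite ler_pM// gG'.
  have hgx : - (e / 2) <= g x - g z.
    have h1 : e1 * `|(k * s) *: y| <= s * (k * (e1 * M)).
      apply: le_trans (ler_wpM2l (ltW e10) nv) _.
      by rewrite /h le_eqVlt; apply/orP; left; apply/eqP; ring.
    have h2 : `|k * s * dot (grad g z) y| <= s * (k * (n%:R * (G' * M))).
      rewrite normrM gtr0_norm// [k * s]mulrC -mulrA ler_pM2l// ler_pM2l//.
    have h3 : s * (k * Gs) = s * (k * (n%:R * (G' * M))) + s * (k * (e1 * M)) + s * k.
      by rewrite /Gs; ring.
    have sk : 0 < s * k by rewrite mulr_gt0.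
    move: hd h2; rewrite !ler_norml => /andP[u1 u2] /andP[u3 u4].
    by move: h1 h3 sk sG u1 u2 u3 u4; clear; lra.
  have := ha z y zr yM => haz.
  have hs : s * (- (k * dot (grad g z) y) - C y) <= s * a z by rewrite ler_pM2l.
  have hs2 : s * - (e / 2) <= s * (g x - g z) by rewrite ler_pM2l.
  move: hd; rewrite ler_norml => /andP[u1 u2]; rewrite /b.
  set q := dot _ _ in u1 u2 hs haz hdot *.
  have e2 : s * (- (k * q) - C y) = - (k * s * q) - s * C y by ring.
  rewrite e2 in hs.
  by move: hs hs2 hv u1 u2; clear; lra.
have bu : bdd_supp (fun x : 'rV[R]_n => `|x|) (cut r f).
  apply: (@cut_bdd_supp _ _ _ (expR G)); [exact: expR_ge0|exact: mf|].
  by move=> x xr; rewrite f0 fG// (le_trans xr)// lerDl.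
have bv : bdd_supp (fun x : 'rV[R]_n => `|x|) (cut M (fun y => expR (- C y))).
  apply: (@cut_bdd_supp _ _ _ (expR c)); first exact: expR_ge0.
    by apply: measurableT_comp => //; exact: measurableT_comp.
  move=> y /Cc; rewrite ler_norml expR_ge0/= ler_expR lerNl => /andP[]//.
have bw : bdd_supp (fun x : 'rV[R]_n => `|x|) (cut (r + h) w).
  apply: (@cut_bdd_supp _ _ _ (expR (G + 2^-1))); [exact: expR_ge0|exact: mw|].
  move=> x /rh1 xr; rewrite expR_ge0/= ler_expR lerD//.
    by move: (gG _ xr); rewrite ler_norml => /andP[].
  apply: le_trans sB; rewrite ler_pM2l//.
  by move: (bB _ xr); rewrite ler_norml => /andP[].
have uvw x y : cut r f x `^ (1 - s) * cut M (fun y => expR (- C y)) y `^ s <=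
    cut (r + h) w (x + (k * s) *: y).
  have w0 z : 0 <= cut (r + h) w z by rewrite /cut; case: ifP => // _; exact: expR_ge0.
  have [xr|xr] := boolP (`|x| <= r); last first.
    by rewrite {1}/cut (negbTE xr) powR0 ?mul0r// subr_eq0 gt_eqF.
  have [yM|yM] := boolP (`|y| <= M); last first.
    by rewrite {2}/cut (negbTE yM) powR0 ?mulr0// gt_eqF.
  rewrite /cut xr yM ifT; last first.
    apply: le_trans (ler_normD _ _) _; rewrite lerD//.
    by rewrite normrZ gtr0_norm// /h mulrCA -mulrA ler_pM2l// ler_pM2l.
  rewrite /f -!expRM -expRD ler_expR mulrC [- C y * s]mulrC mulrN.
  exact: key.
have PL := prekopa_leindler s01 ks0 bu bv bw uvw.
have := le_trans (pl_lhs_ge n s01 k0 P0 L0) PL => {}PL.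
have rr1 x : `|x| <= r -> `|x| <= r + 1 by move=> /rrh /rh1.
have iA : (lebesgue_rV n).-integrable setT (EFin \o cut (r + h) f).
  apply: (@cut_integrable _ _ _ (expR G)) => // x /rh1 xr.
  by rewrite ger0_norm// fG.
have iC : (lebesgue_rV n).-integrable setT (EFin \o cut r f).
  apply: (@cut_integrable _ _ _ (expR G)) => // x /rr1 xr.
  by rewrite ger0_norm// fG.
have iB : (lebesgue_rV n).-integrable setT (EFin \o cut r (fun x => f x * b x)).
  apply: (@cut_integrable _ _ _ (expR G * B')) => //; first exact: measurable_funM.
  by move=> x /rr1 xr; rewrite normrM ger0_norm// ler_pM ?fG// bB.
(* The combination of three truncated integrals below has integrand
   [f * (1 + s * b + 2 * (s * B') ^+ 2)] on the inner ball and [k1 * f] on the shell, where [b] is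
   simply bounded by [B']. *)
pose k1 := 1 + s * B' + 2 * (s * B') ^+ 2.
have [iL eL] := Rintegral_lin3 k1 s (- (s * B')) iA iB iC.
have Wle : \int[lebesgue_rV n]_x cut (r + h) w x <=
    k1 * psi (r + h) + s * I + - (s * B') * psi r.
  rewrite -eL; apply: le_Rintegral => //; first exact: bdd_supp_rV_integrable.
  move=> x _; rewrite /cut.
  have wq : `|x| <= r + h -> w x <= f x * (1 + s * b x + 2 * (s * b x) ^+ 2).
    move=> /rh1 xr; rewrite /w expRD ler_wpM2l// expR_le_quadratic//.
    apply: le_trans sB; rewrite ler_pM2l//.
    by move: (bB _ xr); rewrite ler_norml => /andP[].
  have b2 : `|x| <= r + h -> (s * b x) ^+ 2 <= (s * B') ^+ 2.
    move=> /rh1 xr; rewrite !exprMn ler_wpM2l ?sqr_ge0//.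
    rewrite -[leLHS]real_normK ?num_real//.
    by rewrite ler_pXn2r ?nnegrE ?(ltW B'0)// bB.
  have [xr|xr] := boolP (`|x| <= r).
    have xrh := rrh _ _ xr; rewrite xrh; apply: le_trans (wq xrh) _.
    have := ler_wpM2l (f0 x) (b2 xrh).
    rewrite /k1; set q1 := (s * b x) ^+ 2; set q2 := (s * B') ^+ 2.
    by clear; lra.
  case: ifP => xrh; last by rewrite !mulr0 !addr0.
  apply: le_trans (wq xrh) _; rewrite !mulr0 !addr0 mulrC ler_wpM2r//.
  rewrite /k1 lerD//; last by rewrite ler_pM2l// b2.
  rewrite lerD2l ler_pM2l//.
  by move: (bB _ (rh1 _ _ xrh)); rewrite ler_norml => /andP[].
have psih : psi (r + h) <= psi r + e * h.
  by have := shell h; rewrite h0 sd0 => /(_ isT); rewrite lerBlDl.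
have k10 : 0 <= k1.
  by rewrite !addr_ge0// ?mulr_ge0 ?sqr_ge0 ?ltW//.
have := le_trans PL Wle => {}PL.
rewrite -(ler_pM2l s0).
have hh : e * h <= e * d0 by rewrite ler_pM2l// ltW.
have q0 : 0 <= 2 * (s * B') ^+ 2 by rewrite mulr_ge0 ?sqr_ge0.
have W2 : k1 * psi (r + h) <= k1 * (psi r + e * h) by rewrite ler_wpM2l.
have W3 : 2 * (s * B') ^+ 2 * (psi r + e * h) <= 2 * (s * B') ^+ 2 * (psi r + e * d0).
  by rewrite ler_wpM2l// lerD2l.
have sD' : s * (s * (D + 1)) <= s * eta by rewrite ler_pM2l.
have ss : 0 <= s * s by rewrite mulr_ge0 ?(ltW s0).
move: PL W2 W3 sD' ss; rewrite /k1 /D /h.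
set X := n%:R * ln k; set P := psi r; set P' := psi (r + _).
set lL := ln L; set lP := ln P.
by clear; lra.
Unshelve. all: by end_near. Qed.

(** * Removal of the truncations and optimization in [k] *)

Lemma cut_integrableT (R : realType) n (r : R) (f : 'rV[R]_n -> R) :
  (lebesgue_rV n).-integrable setT (EFin \o f) ->
  (lebesgue_rV n).-integrable setT (EFin \o cut r f).
Proof.
move=> jf; have mf : measurable_fun setT f.
  by apply/measurable_EFinP; exact: (measurable_int (lebesgue_rV n)).
apply: le_integrable jf => //.
  by apply/measurable_EFinP; exact: measurable_cut.
by move=> x _ /=; rewrite lee_fin /cut; case: ifP => // _; rewrite normr0.
Qed.

Lemma cvg_Rintegral_cut (R : realType) n (f : 'rV[R]_n -> R) (r : nat -> R) :
  (lebesgue_rV n).-integrable setT (EFin \o f) -> (forall k, k%:R <= r k) ->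
  \int[lebesgue_rV n]_x cut (r k) f x @[k --> \oo] --> \int[lebesgue_rV n]_x f x.
Proof.
move=> jf rk; apply: fine_cvg.
rewrite fineK; last exact: integrable_fin_num.
apply: (@dominated_cvg _ _ _ _ _ _ (fun k => EFin \o cut (r k) f) (EFin \o f)
  (fun x => `|(f x)%:E|%E)) => //.
- by move=> k; exact: (measurable_int (lebesgue_rV n) (cut_integrableT (r k) jf)).
- move=> x _; apply: cvg_near_cst; near=> k; rewrite /= /cut ifT//.
  by apply: le_trans (rk k); near: k; exact: nbhs_infty_ger.
- exact: integrable_abse jf.
- move=> k x _; rewrite /= /cut; case: ifP => // _.
  by rewrite normr0 lee_fin.
Unshelve. all: by end_near. Qed.

Lemma le_Rintegral_cut (R : realType) n (r r' : R) (f : 'rV[R]_n -> R) :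
  (lebesgue_rV n).-integrable setT (EFin \o f) -> (forall x, 0 <= f x) -> r <= r' ->
  \int[lebesgue_rV n]_x cut r f x <= \int[lebesgue_rV n]_x cut r' f x /\
  \int[lebesgue_rV n]_x cut r f x <= \int[lebesgue_rV n]_x f x.
Proof.
move=> jf f0 rr; split; apply: le_Rintegral => //; try exact: cut_integrableT.
- move=> x _; rewrite /cut; case: ifP => [xr|_]; last by case: ifP.
  by rewrite (le_trans xr rr).
- by move=> x _; rewrite /cut; case: ifP.
Qed.

(** [A] stands for an extended-valued majorant of $\sup_y(-k \nabla g \cdot y - C(y))$. The radius
    [M] is kept because the shell error is proportional to it. *)
Lemma entropy_bound_ball (R : realType) n (g C : 'rV[R]_n -> R)
    (A : 'rV[R]_n -> \bar R) (k M : R) :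
  class_C1 g -> continuous C -> 0 < k -> 0 < M ->
  (lebesgue_rV n).-integrable setT (fun x => (expR (g x))%:E) ->
  (lebesgue_rV n).-integrable setT (fun x => (g x * expR (g x))%:E) ->
  measurable_fun setT A -> (forall x, (0 <= A x)%E) ->
  (lebesgue_rV n).-integrable setT (fun x => A x * (expR (g x))%:E)%E ->
  (forall x y, ((- (k * dot (grad g x) y) - C y)%:E <= A x)%E) ->
  (\int[lebesgue_rV n]_x expR (g x)) * (n%:R * ln k + n%:R +
    ln (\int[lebesgue_rV n]_x cut M (fun y => expR (- C y)) x) -
    ln (\int[lebesgue_rV n]_x expR (g x))) <=
  fine (\int[lebesgue_rV n]_x (A x * (expR (g x))%:E))%E -
    \int[lebesgue_rV n]_x (g x * expR (g x)).
Proof.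
move=> gC1 cC k0 M0 jf jgf mA A0 jA hA.
have mAf : measurable_fun setT (fun x => A x * (expR (g x))%:E)%E.
  by case/integrableP: jA.
have [dg cdg] := gC1.
have cg : continuous g by move=> x; exact: differentiable_continuous.
have mg := continuous_rV_measurable cg.
pose f x := expR (g x); have f0 x : 0 <= f x by exact: expR_ge0.
have mf : measurable_fun setT f by exact: measurableT_comp.
pose psi r := \int[lebesgue_rV n]_x cut r f x.
set Z := \int[_]_x expR (g x); set H := \int[_]_x (g x * _); set E := fine _.
set L := \int[_]_x cut M _ x; set X := _ + ln L.
have psi_mono : {homo psi : x y / x <= y}.
  by move=> x y xy; case: (le_Rintegral_cut jf f0 xy).
have psiZ r : psi r <= Z by case: (le_Rintegral_cut jf f0 (lexx r)).
have key (e N : R) : 0 < e -> 0 < N -> exists2 r, N <= r &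
    psi r * (X - ln (psi r)) <= e * (k * M) + E + e * psi r -
      \int[lebesgue_rV n]_x cut r (fun x => g x * f x) x.
  move=> e0 N0.
  have [r Nr [d d0 rd]] := bounded_monotone_small_growth N psi_mono psiZ e0.
  exists r => //; have r0 : 0 < r by exact: lt_le_trans Nr.
  have [G' G'0 gG'] : exists2 G', 0 < G' & forall x, `|x| <= r + 1 -> `|grad g x| <= G'.
    have cng : continuous (fun x => `|grad g x|).
      by move=> x; apply: continuous_comp; [exact: cdg|exact: norm_continuous].
    have [G' G'0 h] := rV_ball_bounded (r + 1) cng.
    by exists G' => // x /h; rewrite normr_id.
  have [c c0 Cc] := rV_ball_bounded M cC.
  pose B := k * (n%:R * (G' * M)) + c.
  have B0 : 0 <= B by rewrite addr_ge0 ?(ltW c0)// !mulr_ge0// ltW.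
  (* A real-valued bounded function is required, whereas [A] may be infinite. [B] bounds the
     expressions to be majorized on the two balls in play, so capping [A] at [B] preserves the
     majorization there. *)
  pose a x := fine (mine (A x) B%:E).
  have aE x : (a x)%:E = mine (A x) B%:E.
    rewrite /a fineK// ge0_fin_numE; last by rewrite le_min A0 lee_fin.
    by rewrite gt_min ltry orbT.
  have a0 x : 0 <= a x by rewrite -lee_fin aE le_min A0 lee_fin.
  have aB x : a x <= B by rewrite -lee_fin aE ge_min lexx orbT.
  have ma : measurable_fun setT a.
    apply/measurable_EFinP; rewrite (_ : _ \o _ = (fun x => mine (A x) B%:E)).
      exact: measurable_mine.
    exact/funext.
  have haB x y : `|x| <= r + 1 -> `|y| <= M -> - (k * dot (grad g x) y) - C y <= a x.
    move=> xr yM; rewrite -lee_fin aE le_min hA/= lee_fin.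
    have : `|dot (grad g x) y| <= n%:R * (G' * M).
      apply: le_trans (dot_le _ _) _; rewrite ler_wpM2l//.
      by rewrite ler_pM// gG'.
    rewrite ler_norml => /andP[h1 _].
    have := Cc y yM; rewrite ler_norml => /andP[h2 _].
    rewrite lerD//; last by rewrite lerNl.
    by rewrite -mulrN ler_pM2l// lerNl.
  have aB' x : `|x| <= r + 1 -> `|a x| <= B by rewrite ger0_norm.
  have := prekopa_leindler_first_order gC1 cC ma k0 M0 r0 e0 d0 rd aB' haB.
  rewrite -/f -/(psi r) -/L -/X => /le_trans; apply.
  have j1 : (lebesgue_rV n).-integrable setT (EFin \o cut r (fun x => g x * f x)).
    exact: cut_integrableT.
  have j2 : (lebesgue_rV n).-integrable setT (EFin \o cut r f) by exact: cut_integrableT.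
  have [c' c'0 gc'] := rV_ball_bounded r cg.
  have j3 : (lebesgue_rV n).-integrable setT (EFin \o cut r (fun x => a x * f x)).
    apply: (@cut_integrable _ _ _ (B * expR c')); first exact: measurable_funM.
    move=> x /gc' xr; rewrite normrM !ger0_norm// ler_pM// ler_expR.
    by move: xr; rewrite ler_norml => /andP[].
  have [_ e3] := Rintegral_lin3 (-1) 1 e j1 j3 j2.
  rewrite (_ : cut r _ = fun x => - 1 * cut r (fun x => g x * f x) x +
      1 * cut r (fun x => a x * f x) x + e * cut r f x); last first.
    apply/funext => x; rewrite /cut; case: ifP => _; last by ring.
    by rewrite /f; ring.
  rewrite e3.
  have : \int[lebesgue_rV n]_x cut r (fun x => a x * f x) x <= E.
    apply: fine_le.
    - by apply: integrable_fin_num => //; exact: j3.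
    - by apply: integrable_fin_num => //; exact: jA.
    - apply: ge0_le_integral => //.
      + by move=> x _; rewrite lee_fin /cut; case: ifP => // _; rewrite mulr_ge0.
      + exact: (measurable_int (lebesgue_rV n) j3).
      + move=> x _; rewrite /cut; case: ifP => // _; last by rewrite mule_ge0// lee_fin.
        by rewrite EFinM lee_wpmul2r ?lee_fin// aE ge_min lexx.
  rewrite -/(psi r); lra.
have kN (m : nat) : 0 < m.+1%:R :> R by [].
have iN (m : nat) : 0 < m.+1%:R^-1 :> R by rewrite invr_gt0.
(* Taking [e] as the inverse of [m.+1] and [r m] at least [m.+1] removes the error and the
   truncation in one limit. *)
have [r rN rP] : exists2 r : nat -> R, forall m, m.+1%:R <= r m & forall m,
    psi (r m) * (X - ln (psi (r m))) <= m.+1%:R^-1 * (k * M) + E + m.+1%:R^-1 * psi (r m) -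
      \int[lebesgue_rV n]_x cut (r m) (fun x => g x * f x) x.
  have /choice[r rP] : forall m : nat, exists r, m.+1%:R <= r /\
      psi r * (X - ln (psi r)) <= m.+1%:R^-1 * (k * M) + E + m.+1%:R^-1 * psi r -
      \int[lebesgue_rV n]_x cut r (fun x => g x * f x) x.
    by move=> m; have [r h1 h2] := key _ _ (iN m) (kN m); exists r.
  by exists r => m; case: (rP m).
have rm m : m%:R <= r m by apply: le_trans (rN m); rewrite ler_nat.
have cpsi : psi (r m) @[m --> \oo] --> Z by exact: cvg_Rintegral_cut.
have cH : \int[lebesgue_rV n]_x cut (r m) (fun x => g x * f x) x @[m --> \oo] --> H.
  exact: cvg_Rintegral_cut.
have Z0 : 0 < Z.
  by apply: lt_le_trans (psiZ 1); exact: Rintegral_cut_expR_gt0.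
have cinv : (m.+1%:R^-1 : R) @[m --> \oo] --> (0 : R) by exact: cvg_harmonic.
have clhs : psi (r m) * (X - ln (psi (r m))) @[m --> \oo] --> Z * (X - ln Z).
  apply: cvgM => //; apply: cvgB; first exact: cvg_cst.
  by apply: continuous_cvg cpsi; exact: continuous_ln.
have crhs : m.+1%:R^-1 * (k * M) + E + m.+1%:R^-1 * psi (r m) -
    \int[lebesgue_rV n]_x cut (r m) (fun x => g x * f x) x @[m --> \oo] -->
    0 * (k * M) + E + 0 * Z - H.
  apply: cvgB => //; apply: cvgD; last exact: cvgM.
  by apply: cvgD; [apply: cvgM => //; exact: cvg_cst|exact: cvg_cst].
have := ler_cvg_to clhs crhs (nearW _ rP).
by rewrite !mul0r add0r addr0; apply.
Qed.

(** Integrability of $e^{-C}$ must be established before [gibbs_mass C] means anything: the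
    real-valued integral of a nonnegative function with infinite integral is 0. *)
Lemma entropy_bound (R : realType) n (g C : 'rV[R]_n -> R)
    (A : 'rV[R]_n -> \bar R) (k : R) :
  class_C1 g -> continuous C -> 0 < k ->
  (lebesgue_rV n).-integrable setT (fun x => (expR (g x))%:E) ->
  (lebesgue_rV n).-integrable setT (fun x => (g x * expR (g x))%:E) ->
  measurable_fun setT A -> (forall x, (0 <= A x)%E) ->
  (lebesgue_rV n).-integrable setT (fun x => A x * (expR (g x))%:E)%E ->
  (forall x y, ((- (k * dot (grad g x) y) - C y)%:E <= A x)%E) ->
  0 < gibbs_mass C /\
  (\int[lebesgue_rV n]_x expR (g x)) * (n%:R * ln k + n%:R +
    ln (gibbs_mass C) - ln (\int[lebesgue_rV n]_x expR (g x))) <=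
  fine (\int[lebesgue_rV n]_x (A x * (expR (g x))%:E))%E -
    \int[lebesgue_rV n]_x (g x * expR (g x)).
Proof.
move=> gC1 cC k0 jf jgf mA A0 jA hA.
have cg : continuous g by move=> x; apply: differentiable_continuous; case: gC1.
have mC : measurable_fun setT (fun y => expR (- C y)).
  apply: measurableT_comp => //; apply: measurableT_comp => //.
  exact: continuous_rV_measurable.
have cNC : continuous (fun y => - C y) by move=> x; apply: continuousN; exact: cC.
pose LM M := \int[lebesgue_rV n]_x cut M (fun y => expR (- C y)) x.
have LM0 M : 0 < M -> 0 < LM M by exact: Rintegral_cut_expR_gt0.
have HM M : 0 < M -> _ := fun M0 => entropy_bound_ball gC1 cC k0 M0 jf jgf mA A0 jA hA.
set Z := \int[_]_x expR (g x) in HM *; set Y := _ - _ in HM *.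
have Z0 : 0 < Z.
  have [_ h] := le_Rintegral_cut jf (fun x => expR_ge0 (g x)) (lexx 1).
  by apply: lt_le_trans h; exact: Rintegral_cut_expR_gt0.
(* The bound [HM] solved for the logarithm of [LM M]; it does not depend on [M], so monotone
   convergence gives a finite mass. *)
pose X := Y / Z - n%:R * ln k - n%:R + ln Z.
have LMX M : 0 < M -> LM M <= expR X.
  move=> M0; rewrite -[LM M]lnK ?posrE ?LM0// ler_expR /X.
  have := HM _ M0; rewrite mulrC -ler_pdivlMr// -/(LM M); lra.
have jcut M : (lebesgue_rV n).-integrable setT (EFin \o cut M (fun y => expR (- C y))).
  have [c c0 Cc] := rV_ball_bounded M cNC.
  apply: (@cut_integrable _ _ _ (expR c)) => // x /Cc h.
  rewrite ger0_norm ?expR_ge0// ler_expR.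
  by move: h; rewrite ler_norml => /andP[].
have mass_le : (\int[lebesgue_rV n]_x (expR (- C x))%:E <= (expR X)%:E)%E.
  pose F (m : nat) := [set x : 'rV[R]_n | `|x| <= m.+1%:R].
  have FT : \bigcup_m F m = setT.
    apply/seteqP; split => // x _; exists (Num.truncn `|x|) => //.
    by rewrite /F /= ltW// truncnS_gt.
  have mF m : measurable (F m) by exact: measurable_norm_le.
  have ndF : {homo F : m m' / (m <= m')%N >-> (m <= m')%O}.
    move=> m m' mm'; apply/subsetPset => x /le_trans; apply.
    by rewrite ler_nat.
  have mFC m : measurable_fun (F m) (fun x => (expR (- C x))%:E).
    apply: (measurable_funS measurableT) => //; exact/measurable_EFinP.
  have := ge0_nondecreasing_set_cvg_integral (mu := lebesgue_rV n) ndF mF mFC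
    (fun m x _ => expR_ge0 _).
  rewrite FT => cv.
  apply: (lee_cvg_to cv (cvg_cst (expR X)%:E)); apply: nearW => m.
  suff -> : (\int[lebesgue_rV n]_(x in F m) (expR (- C x))%:E = (LM m.+1%:R)%:E)%E.
    by rewrite lee_fin; exact: LMX.
  rewrite /LM /Rintegral fineK; last by apply: integrable_fin_num; [|exact: jcut].
  rewrite [LHS]integral_mkcond; apply: eq_integral => x _; rewrite patchE /cut.
  have [h|h] := boolP (`|x| <= m.+1%:R); first by rewrite mem_set.
  by rewrite memNset//=; exact/negP.
have jC : (lebesgue_rV n).-integrable setT (EFin \o (fun y => expR (- C y))).
  apply/integrableP; split; first exact/measurable_EFinP.
  under eq_integral do rewrite /= ger0_norm ?expR_ge0//.
  by apply: le_lt_trans mass_le _; rewrite ltry.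
have L0 : 0 < gibbs_mass C.
  have [_ h] := le_Rintegral_cut jC (fun x => expR_ge0 (- C x)) (lexx 1).
  by apply: lt_le_trans h; exact: LM0.
split => //.
(* Read backwards, this is the claimed inequality. *)
have : gibbs_mass C <= expR X.
  by rewrite -lee_fin /gibbs_mass fineK//; apply: integrable_fin_num jC.
rewrite -[gibbs_mass C]lnK ?posrE// ler_expR lnK ?posrE// /X => h.
by rewrite mulrC -ler_pdivlMr//; move: h; clear; lra.
Qed.

(** * Entropy, the Legendre transform and the choice of [k] *)

Lemma entropy_expR (R : realType) n (g : 'rV[R]_n -> R) :
  0 < \int[lebesgue_rV n]_x expR (g x) ->
  (lebesgue_rV n).-integrable setT (fun x => (expR (g x))%:E) ->
  (lebesgue_rV n).-integrable setT (fun x => (g x * expR (g x))%:E) ->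
  entropy (fun x => expR (g x)) =
  \int[lebesgue_rV n]_x (g x * expR (g x)) -
  ln (\int[lebesgue_rV n]_x expR (g x)) * \int[lebesgue_rV n]_x expR (g x).
Proof.
move=> Z0 jf jgf; rewrite /entropy; set Z := Rintegral _ _ _ in Z0 *.
have [_ ] := Rintegral_lin3 1 (- ln Z) 0 jgf jf jf.
rewrite mul1r mul0r addr0 mulNr => <-; apply: eq_Rintegral => x _.
by rewrite ln_div ?posrE ?expR_gt0// expRK; ring.
Qed.

Lemma fenchel_ge0 (R : realType) n (C : 'rV[R]_n -> R) x :
  C 0 = 0 -> (0 <= fenchel C x)%E.
Proof.
move=> C0; apply: ereal_sup_ubound; exists 0 => //.
by rewrite C0 subr0 /dot big1// => i _; rewrite mxE mulr0.
Qed.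

(* Testing the supremum at [k `^ (- (q - 1)^-1) *: y] gives one half of the
   [p]-homogeneity of [C^*]. *)
Lemma fenchel_homogeneous_ge (R : realType) n (q p k : R) (C : 'rV[R]_n -> R)
    (x y : 'rV[R]_n) : 1 < q -> p^-1 + q^-1 = 1 -> 0 < k -> homogeneous q C ->
  ((- (k * dot x y) - C y)%:E <= (k `^ p)%:E * fenchel C (- x))%E.
Proof.
move=> q1 pq k0 hC.
have q0 : 0 < q by rewrite (lt_trans ltr01).
have pE : p = q / (q - 1).
  have pi : p^-1 = (q - 1) / q.
    by rewrite -[p^-1](addrK q^-1) pq mulrBl mul1r divff ?gt_eqF.
  by rewrite -[p]invrK pi invf_div.
have q10 : q - 1 != 0 by rewrite subr_eq0 gt_eqF.
pose t := k `^ (- (q - 1)^-1).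
have t0 : 0 < t by rewrite powR_gt0.
have kt : k `^ p * t = k.
  rewrite /t -powRD; last by rewrite (gt_eqF k0) implybT.
  rewrite (_ : p + _ = 1) ?powRr1 ?(ltW k0)//.
  by rewrite pE; field.
have ktq : k `^ p * t `^ q = 1.
  rewrite /t -powRrM -powRD; last by rewrite (gt_eqF k0) implybT.
  by rewrite (_ : p + _ = 0) ?powRr0//; rewrite pE; field.
apply: (@le_trans _ _ ((k `^ p)%:E * (dot (- x) (t *: y) - C (t *: y))%:E)%E).
  rewrite -EFinM lee_fin hC ?(ltW t0)// dotNl dotZr.
  by rewrite mulrBr mulrN !mulrA kt ktq mul1r.
by rewrite lee_pmul2l ?lte_fin ?powR_gt0//; apply: ereal_sup_ubound; exists (t *: y).
Qed.

Theorem corollary3p7 (R : realType) (n : nat) (q p : R) (C : 'rV[R]_n -> R)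
    (hn : (1 <= n)%N) (hq : 1 < q)
    (hC2 : class_C2 C) (hconv : strictly_convex C) (hhom : homogeneous q C)
    (hsuper : superlinear C) (hgrowth : growth_condition C)
    (hp : p^-1 + q^-1 = 1)
    (g : 'rV[R]_n -> R) (hg : smooth_enough C g) :
  entropy (fun x => expR (g x)) <=
    n%:R / p * (\int[lebesgue_rV n]_x expR (g x)) *
    ln (p / (n%:R * expR (p - 1) * gibbs_mass C `^ (p / n%:R)) *
        (fenchel_energy C g / \int[lebesgue_rV n]_x expR (g x))).
Proof.

have [gC1 jf jgf jE] := hg.
have cC : continuous C.
  by move=> x; apply: differentiable_continuous; case: hC2 => -[].
have C0 : C 0 = 0.
  have := hhom 0 0 (lexx _); rewrite scale0r powR0 ?mul0r//.
  by rewrite gt_eqF// (lt_trans ltr01).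
have q0 : 0 < q by rewrite (lt_trans ltr01).
have p0 : 0 < p.
  have : 0 < p^-1.
    have : q^-1 < 1 by rewrite invf_lt1.
    by rewrite -subr_gt0 -hp addrK.
  by rewrite invr_gt0.
have n0 : 0 < n%:R :> R by rewrite ltr0n.
have cg : continuous g by move=> x; apply: differentiable_continuous; case: gC1.
have mg := continuous_rV_measurable cg.
(* Measurability of $C^*(-\nabla g)$ is recovered from that of the integrable product with $e^g$,
   multiplied back by $e^{-g}$. *)
have mF : measurable_fun setT (fun x => fenchel C (- grad g x)).
  rewrite (_ : (fun _ => _) = fun x =>
      (fenchel C (- grad g x) * (expR (g x))%:E) * (expR (- g x))%:E)%E; last first.
    by apply/funext => x; rewrite -muleA -EFinM expRxMexpNx_1 mule1.
  apply: emeasurable_funM; first by case/integrableP: jE.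
  apply/measurable_EFinP; apply: measurableT_comp => //.
  exact: measurableT_comp.
set E := fenchel_energy C g; set Z := \int[_]_x expR _; set L := gibbs_mass C.
pose H := \int[lebesgue_rV n]_x (g x * expR (g x)).
have Z0 : 0 < Z.
  have [_ h] := le_Rintegral_cut jf (fun x => expR_ge0 (g x)) (lexx 1).
  by apply: lt_le_trans h; exact: Rintegral_cut_expR_gt0.
have bound k : 0 < k -> 0 < L /\
    Z * (n%:R * ln k + n%:R + ln L - ln Z) <= k `^ p * E - H.
  move=> k0.
  have kp0 : (0 <= (k `^ p)%:E)%E by rewrite lee_fin powR_ge0.
  have jA : (lebesgue_rV n).-integrable setT (fun x =>
      ((k `^ p)%:E * fenchel C (- grad g x)) * (expR (g x))%:E)%E.
    under eq_fun do rewrite -muleA.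
    exact: integrableZl.
  have [L0 h] := entropy_bound gC1 cC k0 jf jgf (measurable_funeM _ mF)
    (fun x => mule_ge0 kp0 (fenchel_ge0 _ C0)) jA
    (fun x y => fenchel_homogeneous_ge _ _ hq hp k0 hhom).
  split => //; apply: le_trans h _; rewrite lerD2r.
  under eq_integral do rewrite -muleA.
  rewrite integralZl// fineM//.
  exact: integrable_fin_num jE.
have [L0 _] := bound 1 ltr01.
have E0 : 0 <= E.
  apply: fine_ge0; apply: integral_ge0 => x _.
  by rewrite mule_ge0 ?fenchel_ge0 ?lee_fin ?expR_ge0.
rewrite entropy_expR// -/Z -/H; clearbody Z L E H.
have Ep : 0 < E.
  rewrite lt_neqAle E0 andbT eq_sym; apply/negP => /eqP E00.
  (* If [E] were 0, the right-hand side of [bound] would not depend on [k] while $\ln k$ is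
     unbounded; this [t] exceeds the largest admissible $\ln k$ by 1. *)
  pose t := (- H / Z - n%:R - ln L + ln Z) / n%:R + 1.
  have [_] := bound (expR t) (expR_gt0 t).
  rewrite E00 mulr0 sub0r expRK mulrC -ler_pdivlMr// /t mulrDr mulr1 mulrC divfK ?gt_eqF//.
  by move: n0; clear; lra.
pose X := n%:R * Z / (p * E).
have X0 : 0 < X by rewrite divr_gt0 ?mulr_gt0.
have [_] := bound (expR (ln X / p)) (expR_gt0 _).
rewrite expRK -expRM divfK ?gt_eqF// lnK ?posrE//.
have lnX : ln X = ln n%:R + ln Z - (ln p + ln E).
  by rewrite /X ln_div ?posrE ?mulr_gt0// !lnM ?posrE.
rewrite lnX => h.
have lnD : ln (n%:R * expR (p - 1) * L `^ (p / n%:R)) =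
    ln n%:R + (p - 1) + p / n%:R * ln L.
  by rewrite !lnM ?posrE ?mulr_gt0 ?expR_gt0 ?powR_gt0// expRK ln_powR.
have D0 : 0 < n%:R * expR (p - 1) * L `^ (p / n%:R).
  by rewrite !mulr_gt0 ?expR_gt0 ?powR_gt0.
rewrite lnM ?posrE ?divr_gt0// !ln_div ?posrE// lnD.
have XE : X * E = n%:R / p * Z by rewrite /X; field; rewrite !gt_eqF.
rewrite XE in h.
(* The term [n%:R / p * Z], coming from [X * E], and [- n * Z] add up to $-(n/p)(p-1)Z$, the origin
   of $e^{p-1}$ in the statement. *)
rewrite [leRHS](_ : _ = n%:R / p * Z - Z * (n%:R * ((ln n%:R + ln Z - (ln p + ln E)) / p) +
  n%:R + ln L)).
  move: h; set u := n%:R * (_ / p); set v := n%:R / p * Z.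
  by clear; lra.
by field; rewrite !gt_eqF.
Qed.
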